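(* Let $(X_t)_{t\ge 0}$ be a Lévy process in $\mathbb{R}^d$ with infinitesimal generator $(A,\mathcal{D}(A))$ and characteristic exponent $\psi:\mathbb{R}^d\to\mathbb{C}$ satisfying the Hartman–Wintner condition $$\lim_{|\xi|\to\infty}\frac{\operatorname{Re}\psi(\xi)}{\log|\xi|}=\infty .$$ Assume that there exist constants $M>0$, $T>0$ and $\alpha\in(0,2]$ such that the transition density $p_t$ of $(X_t)_{t\ge0}$ satisfies $$\int_{\mathbb{R}^d}|\nabla p_t(x)|\,dx\le M t^{-1/\alpha},\qquad t\in(0,T].$$ If $f\in\mathcal{D}(A)$ is such that $$Af+\varrho f=g\in\mathcal{C}_b^{\delta}(\mathbb{R}^d)$$ for some $\delta\ge0$ and $\varrho\in\mathbb{R}$, then $f\in\mathcal{C}_b^{\alpha+\delta}(\mathbb{R}^d)$ and the Schauder estimate $$\|f\|_{\mathcal{C}_b^{\alpha+\delta}(\mathbb{R}^d)}\le L\left(\|g\|_{\mathcal{C}_b^{\delta}(\mathbb{R}^d)}+\|f\|_{\infty}\right)$$ holds for a finite constant $L=L(\varrho,\delta,\alpha,M,d,T)$ depending only on the listed quantities. In particular, $\mathcal{D}(A)\subseteq\mathcal{C}_\infty^{\alpha}(\mathbb{R}^d)$.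
   Context: Functions are real-valued. A Lévy process $(X_t)_{t\ge0}$ in $\mathbb{R}^d$ has $X_0=0$ a.s., independent and stationary increments, and a.s. càdlàg paths. Its characteristic exponent $\psi$ is determined by $\mathbb{E}\exp(i\xi\cdot X_t)=\exp(-t\psi(\xi))$, $t\ge0$, $\xi\in\mathbb{R}^d$. Under the Hartman–Wintner condition, $X_t$ has for every $t>0$ a density $p_t$ with respect to Lebesgue measure (the transition density), and $p_t$ is smooth with bounded derivatives of all orders. $C_\infty(\mathbb{R}^d)$ is the space of continuous functions vanishing at infinity; $C^k_\infty(\mathbb{R}^d)$ consists of functions which, together with their derivatives up to order $k$, belong to $C_\infty(\mathbb{R}^d)$; $C_b(\mathbb{R}^d)$ is the space of bounded continuous functions. With $P_tf(x)=\mathbb{E}f(x+X_t)$, the generator is: $\mathcal{D}(A)$ is the set of $f\in C_\infty(\mathbb{R}^d)$ for which there is $g\in C_\infty(\mathbb{R}^d)$ with $\lim_{t\to0}\|t^{-1}(P_tf-f)-g\|_\infty=0$, and then $Af:=g$. Hölder–Zygmund spaces: $\Delta_hf(x)=f(x+h)-f(x)$, $\Delta_h^jf=\Delta_h(\Delta_h^{j-1}f)$ for $j\ge2$. For $\gamma\ge0$, with $\lfloor\gamma\rfloor$ the largest integer $\le\gamma$, $$\mathcal{C}_b^\gamma(\mathbb{R}^d)=\Big\{f\in C_b(\mathbb{R}^d):\ \|f\|_{\mathcal{C}_b^\gamma(\mathbb{R}^d)}:=\|f\|_\infty+\sup_{x\in\mathbb{R}^d,\,h\ne0}\frac{|\Delta_h^{\lfloor\gamma\rfloor+1}f(x)|}{|h|^\gamma}<\infty\Big\}.$$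 For $\gamma>0$, $\mathcal{C}_\infty^\gamma(\mathbb{R}^d):=\mathcal{C}_b^\gamma(\mathbb{R}^d)\cap C_\infty^{k}(\mathbb{R}^d)$ where $k=\max\{j\in\mathbb{N}_0: j<\gamma\}$. *)

(* Defs.v *)
From HB Require Import structures.
From mathcomp Require Import all_boot all_order all_algebra.
From mathcomp Require Import archimedean.
From mathcomp Require Import all_classical all_reals all_analysis.
From mathcomp.real_closed Require Import complex.

Set Implicit Arguments.
Unset Strict Implicit.
Unset Printing Implicit Defensive.

Import Order.TTheory GRing.Theory Num.Theory.
Import numFieldTopology.Exports numFieldNormedType.Exports.

Local Open Scope classical_set_scope.
Local Open Scope ring_scope.

(* ['rV[T]_n] carries the product sigma-algebra, as [n.-tuple T] does in the
   library; for [T = R] this is the Borel sigma-algebra of R^n. *)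
Section measurable_rV.
Context {d} {T : sigmaRingType d}.
Variable n : nat.

Let coors : 'I_n -> 'rV[T]_n -> T := fun i x => x ord0 i.

Let rV_set0 : g_sigma_preimage coors set0.
Proof. exact: sigma_algebra0. Qed.

Let rV_setC A : g_sigma_preimage coors A -> g_sigma_preimage coors (~` A).
Proof. exact: sigma_algebraC. Qed.

Let rV_bigcup (F : _^nat) : (forall i, g_sigma_preimage coors (F i)) ->
  g_sigma_preimage coors (\bigcup_i (F i)).
Proof. exact: sigma_algebra_bigcup. Qed.

HB.instance Definition _ := @isMeasurable.Build (measure_tuple_display d)
  ('rV[T]_n) (g_sigma_preimage coors) rV_set0 rV_setC rV_bigcup.

End measurable_rV.

Section measurable_rV_theory.
Context d1 d2 (T1 : measurableType d1) (T2 : measurableType d2).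

Lemma measurable_coord n (i : 'I_n) :
  measurable_fun [set: 'rV[T2]_n] (fun x => x ord0 i).
Proof.
move=> _ Y mY; rewrite setTI; apply: sub_sigma_algebra => /=.
rewrite -bigcup_seq/=; exists i => /=; first by rewrite mem_index_enum.
by exists Y => //; rewrite setTI.
Qed.

Lemma measurable_fun_rV n (f : T1 -> 'rV[T2]_n) :
  (forall i, measurable_fun [set: T1] (fun x => f x ord0 i)) ->
  measurable_fun [set: T1] f.
Proof.
move=> mf _ A mA; rewrite setTI.
pose C : set (set 'rV[T2]_n) := [set B | measurable (f @^-1` B)].
suff : measurable `<=` C by exact.
apply: smallest_sub.
- split => /=.
  + by rewrite /C /= preimage_set0.
  + by move=> B; rewrite /C /= setTD preimage_setC => /measurableC.
  + by move=> F mF; rewrite /C /= preimage_bigcup; exact: bigcupT_measurable.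
- move=> B; rewrite -bigcup_seq => -[i _ [Y mY <-]].
  by rewrite setTI /C /=; have := mf i measurableT Y mY; rewrite setTI.
Qed.

End measurable_rV_theory.

Section lebesgue_rV.
Context (R : realType).

Definition rV_cons n (p : measurableTypeR R * 'rV[R]_n) : 'rV[R]_n.+1 :=
  \row_(i < n.+1) if unlift ord0 i is Some j then p.2 ord0 j else p.1.

Definition rV_split n (v : 'rV[R]_n.+1) : measurableTypeR R * 'rV[R]_n :=
  (v ord0 ord0, \row_(i < n) v ord0 (lift ord0 i)).

Lemma rV_consK n : cancel (@rV_cons n) (@rV_split n).
Proof.
case=> x v; rewrite /rV_split /rV_cons mxE unlift_none; congr pair.
by apply/rowP => i; rewrite !mxE liftK.
Qed.

Lemma measurable_rV_cons n :
  measurable_fun [set: measurableTypeR R * 'rV[R]_n] (@rV_cons n).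
Proof.
apply: measurable_fun_rV => i.
case: (unliftP ord0 i) => [j ->|->].
- apply: (eq_measurable_fun (fun p : measurableTypeR R * 'rV[R]_n => p.2 ord0 j)).
    by move=> p _; rewrite mxE liftK.
  exact: (measurableT_comp (measurable_coord j) measurable_snd).
- apply: (eq_measurable_fun (fun p : measurableTypeR R * 'rV[R]_n => p.1)).
    by move=> p _; rewrite mxE unlift_none.
  exact: measurable_fst.
Qed.

Lemma measurable_rV_split n : measurable_fun [set: 'rV[R]_n.+1] (@rV_split n).
Proof.
apply: measurable_fun_pair; first exact: measurable_coord.
apply: measurable_fun_rV => i.
apply: (eq_measurable_fun (fun v : 'rV[R]_n.+1 => v ord0 (lift ord0 i))).
  by move=> v _; rewrite mxE.
exact: measurable_coord.
Qed.

Section step.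
Context (n : nat) (mu : {sigma_finite_measure set 'rV[R]_n -> \bar R}).

Definition lebesgue_cons : set 'rV[R]_n.+1 -> \bar R :=
  pushforward (@lebesgue_measure R \x mu)%E (@rV_cons n).

Let m : {measure set 'rV[R]_n.+1 -> \bar R} :=
  measure_function_pushforward__canonical__measure_function_Measure
    (@lebesgue_measure R \x mu)%E (@measurable_rV_cons n).

HB.instance Definition _ := Measure.copy lebesgue_cons m.

Let lebesgue_cons_sigma_finite : sigma_finite setT lebesgue_cons.
Proof.
have /sigma_finiteP[F [FT ndF Foo]] := sigma_finiteT (@lebesgue_measure R).
have /sigma_finiteP[G [GT ndG Goo]] := sigma_finiteT mu.
exists (fun k => @rV_split n @^-1` (F k `*` G k)) => [|k].
- apply/seteqP; split => // v _ /=.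
  have [i _ Fi] : (\bigcup_i F i) (v ord0 ord0) by rewrite -FT.
  have [j _ Gj] : (\bigcup_j G j) (\row_(i < n) v ord0 (lift ord0 i)).
    by rewrite -GT.
  exists (maxn i j) => //; split.
  + by move: Fi; exact/subsetPset/ndF/leq_maxl.
  + by move: Gj; exact/subsetPset/ndG/leq_maxr.
- have [mF Fk] := Foo k; have [mG Gk] := Goo k.
  have mFG : measurable (F k `*` G k) by exact: measurableX.
  split.
    by rewrite -[X in measurable X]setTI; exact: measurable_rV_split.
  rewrite /lebesgue_cons /pushforward -comp_preimage.
  rewrite (_ : _ \o _ = id); last by apply/funext => x; exact: rV_consK.
  by rewrite preimage_id product_measure1E// lte_mul_pinfty// ge0_fin_numE.
Qed.

HB.instance Definition _ :=
  Measure_isSigmaFinite.Build _ _ _ lebesgue_cons lebesgue_cons_sigma_finite.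

End step.

(* Lebesgue measure on R^n, by iterated products; on the one-point space R^0
   it is the Dirac mass. *)
Fixpoint lebesgue_rV n : {sigma_finite_measure set 'rV[R]_n -> \bar R} :=
  match n with
  | 0 => [the {sigma_finite_measure set 'rV[R]_0 -> \bar R} of
            @dirac _ 'rV[R]_0 0 R]
  | n'.+1 => [the {sigma_finite_measure set 'rV[R]_n'.+1 -> \bar R} of
                lebesgue_cons (lebesgue_rV n')]
  end.

End lebesgue_rV.

(* The library norm on ['rV[R]_n] is the sup norm; [enorm] is the Euclidean
   one. *)
Section euclidean.
Context (R : realType) (n : nat).
Implicit Types x y : 'rV[R]_n.

Definition dot x y : R := \sum_(i < n) x ord0 i * y ord0 i.

Definition enorm x : R := Num.sqrt (dot x x).

Definition at_infty : set_system 'rV[R]_n :=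
  [set A | exists r : R, forall x, r < enorm x -> A x].

Global Instance at_infty_filter : Filter at_infty.
Proof.
split; first by exists 0.
- move=> A B [r rA] [s sB]; exists (Num.max r s) => x.
  by rewrite gt_max => /andP[/rA Ax /sB].
- by move=> A B AB [r rA]; exists r => x /rA /AB.
Qed.

End euclidean.
Arguments at_infty : clear implicits.

Section function_spaces.
Context (R : realType) (n : nat).
Implicit Types (f : 'rV[R]_n -> R) (h x : 'rV[R]_n).

Definition supnorm f : \bar R :=
  ereal_sup [set `|f x|%:E | x in [set: 'rV[R]_n]].

Definition C_b : set ('rV[R]_n -> R) :=
  [set f | continuous f /\ (supnorm f < +oo)%E].

Definition C_infty : set ('rV[R]_n -> R) :=
  [set f | continuous f /\ f x @[x --> at_infty R n] --> 0].

Definition partial (i : 'I_n) f : 'rV[R]_n -> R := 'D_(delta_mx ord0 i) f.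

Definition gradient f x : 'rV[R]_n := \row_(i < n) partial i f x.

(* f and all its partial derivatives up to order k exist and belong to S *)
Fixpoint derivs_in (S : set ('rV[R]_n -> R)) (k : nat) f : Prop :=
  S f /\
  match k with
  | 0 => True
  | k'.+1 => forall i : 'I_n,
      (forall x, derivable f x (delta_mx ord0 i)) /\ derivs_in S k' (partial i f)
  end.

Definition Ck_infty (k : nat) : set ('rV[R]_n -> R) :=
  [set f | derivs_in C_infty k f].

Definition smooth_bounded : set ('rV[R]_n -> R) :=
  [set f | forall k, derivs_in C_b k f].

Definition fdiff h f : 'rV[R]_n -> R := fun x => f (x + h) - f x.

(* for gamma >= 0, [Num.truncn gamma] is the floor of gamma *)
Definition holder_seminorm (gamma : R) f : \bar R :=
  ereal_sup [set (`|iter (Num.truncn gamma).+1 (fdiff xh.2) f xh.1|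
                    / enorm xh.2 `^ gamma)%:E
            | xh in [set xh : 'rV[R]_n * 'rV[R]_n | xh.2 != 0]].

Definition holder_norm (gamma : R) f : \bar R :=
  (supnorm f + holder_seminorm gamma f)%E.

Definition Cb_gamma (gamma : R) : set ('rV[R]_n -> R) :=
  [set f | C_b f /\ (holder_norm gamma f < +oo)%E].

(* the largest natural number j < gamma, for gamma > 0 *)
Definition max_below (gamma : R) : nat :=
  \max_(j < (Num.truncn gamma).+1 | (j%:R < gamma)%R) j.

Definition Cinfty_gamma (gamma : R) : set ('rV[R]_n -> R) :=
  Cb_gamma gamma `&` Ck_infty (max_below gamma).

End function_spaces.

Section levy.
Context (R : realType) (d : nat) (disp : measure_display)
  (Omega : measurableType disp) (P : probability Omega R).

(* mutual independence; taking some [B k] to be [setT] gives the product rule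
   for every subfamily *)
Definition mutually_independent m (Y : 'I_m -> Omega -> 'rV[R]_d) : Prop :=
  forall B : 'I_m -> set 'rV[R]_d, (forall k, measurable (B k)) ->
    (P [set w | forall k, B k (Y k w)] = \prod_(k < m) P (Y k @^-1` B k))%E.

Variable X : R -> {RV P >-> 'rV[R]_d}.

Definition increment (s t : R) (w : Omega) : 'rV[R]_d := X t w - X s w.

(* [X t] is only ever considered for t >= 0. *)
Record is_levy : Prop := {
  levy_zero : {ae P, forall w, X 0 w = 0} ;
  levy_independent : forall (m : nat) (t : nat -> R),
    0 <= t 0 -> (forall k, t k < t k.+1) ->
    mutually_independent (fun k : 'I_m => increment (t k) (t k.+1)) ;
  levy_stationary : forall s t : R, 0 <= s -> s <= t ->
    forall A : set 'rV[R]_d, measurable A ->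
      P (increment s t @^-1` A) = P (X (t - s) @^-1` A) ;
  levy_cadlag : {ae P, forall w, forall t : R, 0 <= t ->
    X s w @[s --> t^'+] --> X t w /\
    (0 < t -> exists l : 'rV[R]_d, X s w @[s --> t^'-] --> l)}
}.

Definition cexp (z : R[i]) : R[i] :=
  ((expR (complex.Re z) * cos (complex.Im z)) +i*
   (expR (complex.Re z) * sin (complex.Im z)))%C.

Definition cexpectation (Z : Omega -> R[i]) : R[i] :=
  (fine ('E_P[fun w => complex.Re (Z w)])%E +i*
   fine ('E_P[fun w => complex.Im (Z w)])%E)%C.

Definition is_char_exponent (psi : 'rV[R]_d -> R[i]) : Prop :=
  forall (t : R) (xi : 'rV[R]_d), 0 <= t ->
    cexpectation (fun w => cexp (0 +i* dot xi (X t w))%C) =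
    cexp (- (t%:C * psi xi))%C.

Definition hartman_wintner (psi : 'rV[R]_d -> R[i]) : Prop :=
  complex.Re (psi xi) / ln (enorm xi) @[xi --> at_infty R d] --> +oo.

(* Under the Hartman-Wintner condition X t has, for every t > 0, a density
   which is smooth with bounded derivatives of all orders; [p t] is this
   version of the density. *)
Definition is_transition_density (p : R -> 'rV[R]_d -> R) : Prop :=
  forall t : R, 0 < t ->
    [/\ smooth_bounded (p t),
        forall x, 0 <= p t x &
        forall A : set 'rV[R]_d, measurable A ->
          P (X t @^-1` A) = (\int[lebesgue_rV R d]_(x in A) (p t x)%:E)%E].

Definition gradient_bound (p : R -> 'rV[R]_d -> R) (M T alpha : R) : Prop :=
  forall t : R, 0 < t -> t <= T ->
    (\int[lebesgue_rV R d]_x (enorm (gradient (p t) x))%:E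
       <= (M * t `^ (- alpha^-1))%:E)%E.

Definition semigroup (t : R) (f : 'rV[R]_d -> R) : 'rV[R]_d -> R :=
  fun x => fine ('E_P[fun w => f (x + X t w)%R])%E.

(* [is_generator f g] says that f is in D(A) and A f = g. *)
Definition is_generator (f g : 'rV[R]_d -> R) : Prop :=
  [/\ C_infty f, C_infty g &
      supnorm (fun x => t^-1 * (semigroup t f x - f x) - g x) @[t --> 0^'+]
        --> 0%E].

Definition domain_generator : set ('rV[R]_d -> R) :=
  [set f | exists g, is_generator f g].

End levy.

(* Main.v *)
Require Import Defs.
From HB Require Import structures.
From mathcomp Require Import all_boot all_order all_algebra.
From mathcomp Require Import archimedean.
From mathcomp Require Import all_classical all_reals all_analysis.
From mathcomp.real_closed Require Import complex.
From mathcomp Require Import measurable_realfun ring lra.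

(* On bounded measurable functions the transition semigroup [P_t] commutes with
   the difference operators [D_h], and the gradient bound says exactly that
   |D_h P_t u| <= 2 d M |h| t^(-1/alpha) sup|u|.  Writing [P_t] as a fourth power
   of [P_(t/4)] and letting [m] differences fall on [g], with
   m = floor(delta) + 1 and a = |h|^alpha, gives
   |D_h^(m+4) P_t g| <= C |h|^delta (a / (a + t))^2, whose integral over [t] is
   at most C |h|^(alpha + delta).  As e^(rho t) P_t g is the derivative of
   e^(rho t) P_t f, this bounds D_h^(m+4) (e^(rho T) P_T f - f), while P_T f is
   smooth; Marchaud's inequality then lowers the order of the difference from
   m + 4 to floor(alpha + delta) + 1.  The integral is replaced by a telescoping
   sum over a uniform subdivision of [0, T], so that no regularity in [t] is
   needed.  Finally, for alpha > 1 a second difference of order > 1 forces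
   continuous partial derivatives, obtained as uniform limits of quotients. *)

Set Implicit Arguments.
Unset Strict Implicit.
Unset Printing Implicit Defensive.

Import Order.TTheory GRing.Theory Num.Theory.
Import numFieldTopology.Exports numFieldNormedType.Exports.

Local Open Scope classical_set_scope.
Local Open Scope ring_scope.

(** Why four factors: up to constants, each [P_(t/4)] gains [|h| t^(-1/alpha)], hence four gain
    [(a/t)^(4/alpha)]. Since [alpha <= 2], this is at most [(a/t)^2] once [t] exceeds [a]. Two
    factors would only give [a/t] at [alpha = 2] and a logarithm after integration; the square has a
    rational primitive, which is what the telescoping sum follows. Why the constant is uniform in
    the process: the size of [A f] and the speed of convergence in the definition of the generator
    depend on the process, but they only decide how fine the subdivision of [0, T] must be, and the
    error of the subdivision is then sent to 0. What remains depends on [f] and [g] through sup|f|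
    and the difference bound of [g] alone; [T] enters through [P_T f] and through the bound of
    [e^(rho s)] on [0, T]. Why integer orders need no separate treatment: Marchaud's inequality
    reaches any difference order strictly above the exponent, and floor(gamma) + 1 is always such an
    order. *)

(** * Measurability for the product sigma-algebra on R^n *)

Section measurability.
Context (R : realType) (n : nat).

Let floor_approx (k : nat) (x : 'rV[R]_n) : 'rV[R]_n :=
  \row_i ((Num.floor (x ord0 i * k.+1%:R))%:~R / k.+1%:R).

Lemma cvg_rV (u : nat -> 'rV[R]_n) (x : 'rV[R]_n) :
  (forall i, u k ord0 i @[k --> \oo] --> x ord0 i) -> u k @[k --> \oo] --> x.
Proof.
move=> ux; apply/cvgrPdist_lt => e e0.
have : \forall k \near \oo, forall i : 'I_n, `|x ord0 i - u k ord0 i| < e.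
  apply: filter_forall => i.
  by have /cvgrPdist_lt/(_ _ e0) := ux i.
apply: filterS => k ke.
rewrite /Num.norm /= mx_normrE; apply: bigmax_lt => // -[i j] _ /=.
by rewrite !mxE (ord1 i).
Qed.

Let floor_approx_cvg x : floor_approx k x @[k --> \oo] --> x.
Proof.
apply: cvg_rV => i.
have lim0 : (x ord0 i - k.+1%:R^-1) @[k --> \oo] --> x ord0 i.
  rewrite -[X in _ --> X]subr0; apply: cvgB; first exact: cvg_cst.
  exact: cvg_harmonic.
apply: (squeeze_cvgr _ lim0 (cvg_cst (x ord0 i))).
near=> k; rewrite mxE; have k0 : 0 < (k.+1%:R : R) by rewrite ltr0n.
rewrite ler_pdivlMr// ler_pdivrMr// mulrBl mulVf ?gt_eqF//.
apply/andP; split; last by rewrite floor_le_tmp.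
by rewrite lerBlDr; apply: ltW; rewrite -[X in _ + X](mulr1z 1) -intrD floorD1_gt.
Unshelve. all: by end_near.
Qed.

(** The sigma-algebra is generated by coordinates, not by open sets, so [f] is written as the
    pointwise limit of [f \o floor_approx k], which is constant on each of countably many grid
    cells. *)
Lemma continuous_measurable_rV (f : 'rV[R]_n -> R) :
  continuous f -> measurable_fun setT f.
Proof.
move=> cf.
apply: (@measurable_fun_cvg _ _ _ _ (fun k => f \o floor_approx k)); last first.
  move=> x _; apply: continuous_cvg; first exact: cf.
  exact: floor_approx_cvg.
move=> k _ B mB; rewrite setTI.
pose box (z : 'rV[int]_n) : set 'rV[R]_n :=
  [set x | forall i, Num.floor (x ord0 i * k.+1%:R) = z ord0 i].
pose g (z : 'rV[int]_n) : 'rV[R]_n := \row_i ((z ord0 i)%:~R / k.+1%:R).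
(* The cells are enumerated through the countable type of integer vectors; a cell is kept when [f]
   sends its corner into [B]. *)
pose F (j : nat) : set 'rV[R]_n :=
  if (unpickle j : option 'rV[int]_n) is Some z then
    if `[< B (f (g z)) >] then box z else set0 else set0.
have mbox z : measurable (box z).
  have -> : box z = \bigcap_(i in [set: 'I_n])
      ((fun x : 'rV[R]_n => x ord0 i) @^-1`
        [set r : R | Num.floor (r * k.+1%:R) = z ord0 i]).
    by apply/seteqP; split => [x bx i _|x bx i] /=; [exact: bx|exact: (bx i I)].
  apply: fin_bigcap_measurable => // i _.
  rewrite -[X in measurable X]setTI; apply: measurable_coord => //.
  have -> : [set r : R | Num.floor (r * k.+1%:R) = z ord0 i] =
      `[(z ord0 i)%:~R / k.+1%:R, (z ord0 i + 1)%:~R / k.+1%:R[%classic.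
    have k0 : 0 < (k.+1%:R : R) by rewrite ltr0n.
    apply/seteqP; split => r /=; rewrite in_itv/= ler_pdivrMr// ltr_pdivlMr//.
    + by move=> <-; rewrite floor_le_tmp floorD1_gt.
    + by move=> /floor_def.
  exact: measurable_itv.
have -> : (f \o floor_approx k) @^-1` B = \bigcup_j F j.
  apply/seteqP; split => x /=.
    move=> Bx; pose z : 'rV[int]_n := \row_i Num.floor (x ord0 i * k.+1%:R).
    exists (pickle z) => //; rewrite /F pickleK.
    have gz : g z = floor_approx k x by apply/rowP => i; rewrite !mxE.
    by rewrite gz; case: asboolP => // _ i; rewrite mxE.
  move=> [j _]; rewrite /F; case: unpickle => // z; case: asboolP => // Bz bx.
  suff -> : floor_approx k x = g z by [].
  by apply/rowP => i; rewrite !mxE bx.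
apply: bigcupT_measurable => j; rewrite /F.
by case: unpickle => // z; case: asboolP.
Qed.

Lemma measurable_addrV d (T : measurableType d) (f g : T -> 'rV[R]_n) :
  measurable_fun setT f -> measurable_fun setT g ->
  measurable_fun setT (fun x => f x + g x).
Proof.
move=> mf mg; apply: measurable_fun_rV => i.
under eq_fun do rewrite mxE.
by apply: measurable_funD; apply: (measurableT_comp (measurable_coord i)).
Qed.

Lemma measurable_opprV d (T : measurableType d) (f : T -> 'rV[R]_n) :
  measurable_fun setT f -> measurable_fun setT (fun x => - f x).
Proof.
move=> mf; apply: measurable_fun_rV => i.
under eq_fun do rewrite mxE.
by apply: measurableT_comp => //; apply: (measurableT_comp (measurable_coord i)).
Qed.

Lemma measurable_scalerV d (T : measurableType d) (f : T -> R) (v : 'rV[R]_n) :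
  measurable_fun setT f -> measurable_fun setT (fun x => f x *: v).
Proof.
move=> mf; apply: measurable_fun_rV => i.
under eq_fun do rewrite mxE.
by apply: measurable_funM.
Qed.

End measurability.

(** * Translation invariance of Lebesgue measure on R^n *)

Section translation.
Context (R : realType).
Local Open Scope ereal_scope.

Lemma lebesgue_measureDr (c : R) (A : set R) : measurable A ->
  pushforward (@lebesgue_measure R) ((fun x => x + c)%R : _ -> measurableTypeR R) A
  = lebesgue_measure A.
Proof.
have mc : measurable_fun setT ((fun x => x + c)%R : measurableTypeR R -> measurableTypeR R).
  exact: measurable_funD.
move=> mA; apply/esym/(@lebesgue_measure_unique _
  (measure_function_pushforward__canonical__measure_function_Measure
    (@lebesgue_measure R) mc)) => //= _ [[a b]] _ <-.
rewrite /pushforward.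
have -> : (fun x => x + c)%R @^-1` `]a, b]%classic = `](a - c)%R, (b - c)%R]%classic.
  by apply/seteqP; split => x /=; rewrite !in_itv/= ltrBlDr lerBrDr.
rewrite !lebesgue_measure_itv/= !lte_fin ltrD2r.
by case: ifPn => // _; rewrite -!EFinD; congr (_%:E); ring.
Qed.

Lemma ge0_integral_lebesgueDr (c : R) (f : measurableTypeR R -> \bar R) :
  measurable_fun setT f -> (forall x, 0 <= f x) ->
  \int[@lebesgue_measure R]_x f (x + c)%R = \int[@lebesgue_measure R]_x f x.
Proof.
move=> mf f0.
have mc : measurable_fun setT ((fun x => x + c)%R : measurableTypeR R -> measurableTypeR R).
  exact: measurable_funD.
transitivity (\int[pushforward (@lebesgue_measure R)
    ((fun x => x + c)%R : _ -> measurableTypeR R)]_x f x).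
  by rewrite (ge0_integral_pushforward mc).
by apply: eq_measure_integral => //= A mA _; exact: lebesgue_measureDr.
Qed.

Lemma ge0_integral_lebesgue_rVS n (f : 'rV[R]_n.+1 -> \bar R) :
  measurable_fun setT f -> (forall x, 0 <= f x) ->
  \int[lebesgue_rV R n.+1]_x f x =
  \int[@lebesgue_measure R]_s \int[lebesgue_rV R n]_w f (rV_cons (s, w)).
Proof.
move=> mf f0.
have mc := @measurable_rV_cons R n.
have mfc : measurable_fun setT (f \o @rV_cons R n) by exact: (measurableT_comp mf mc).
rewrite -[RHS](fubini_tonelli1 (f \o @rV_cons R n))//; last by move=> x; exact: f0.
exact: (ge0_integral_pushforward mc (@lebesgue_measure R \x lebesgue_rV R n)
  measurableT mf (fun y _ => f0 y)).
Qed.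

(** Induction on the dimension: the first coordinate is translated by the one-dimensional result,
    the others by the induction hypothesis under the outer integral. *)
Lemma ge0_integral_lebesgue_rVD n (v : 'rV[R]_n) (f : 'rV[R]_n -> \bar R) :
  measurable_fun setT f -> (forall x, 0 <= f x) ->
  \int[lebesgue_rV R n]_x f (x + v)%R = \int[lebesgue_rV R n]_x f x.
Proof.
elim: n v f => [|n IH] v f mf f0.
  by apply: eq_integral => x _; congr f; apply/rowP => -[].
have mD : measurable_fun setT (fun x : 'rV[R]_n.+1 => (x + v)%R).
  by apply: measurable_addrV.
have mfv : measurable_fun setT (fun x : 'rV[R]_n.+1 => f (x + v)%R).
  exact: (measurableT_comp mf mD).
rewrite !ge0_integral_lebesgue_rVS//.
have mfc : measurable_fun setT (f \o @rV_cons R n).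
  exact: (measurableT_comp mf (@measurable_rV_cons R n)).
rewrite -[RHS](ge0_integral_lebesgueDr (v ord0 ord0)); last 2 first.
- exact: (measurable_fun_fubini_tonelli_F (f \o @rV_cons R n) mfc (fun x => f0 _)).
- by move=> s; exact: integral_ge0.
apply: eq_integral => s _.
rewrite -[RHS](IH (\row_i v ord0 (lift ord0 i))%R)//; last first.
  by apply: (measurableT_comp mfc); exact: measurable_pair1.
apply: eq_integral => w _; congr f; apply/rowP => i; rewrite !mxE.
by case: (unliftP ord0 i) => [j|] -> //; rewrite !mxE.
Qed.

End translation.

(** * Convolution of bounded measurable functions with a probability *)

Section bounded_measurable.
Context (R : realType) (n : nat).
Implicit Types (u v : 'rV[R]_n -> R) (mu nu rho : probability 'rV[R]_n R).

(** This class is stable under differences and under averaging by any probability, so the semigroup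
    can be iterated on it without any continuity argument. *)
Definition bmeas u : Prop :=
  measurable_fun setT u /\ exists c, forall x, `|u x| <= c.

Lemma bmeas_shift u h : bmeas u -> bmeas (fun x => u (x + h)).
Proof.
move=> [mu [c uc]]; split; last by exists c.
have mh : measurable_fun setT (fun x : 'rV[R]_n => x + h) by apply: measurable_addrV.
exact: (measurableT_comp mu mh).
Qed.

Lemma bmeasB u v : bmeas u -> bmeas v -> bmeas (fun x => u x - v x).
Proof.
move=> [mu [c uc]] [mv [e ve]]; split; first exact: measurable_funB.
by exists (c + e) => x; rewrite (le_trans (ler_normB _ _))// lerD.
Qed.

Lemma bmeasZ a u : bmeas u -> bmeas (fun x => a * u x).
Proof.
move=> [mu [c uc]]; split; first by apply: measurable_funM.
by exists (`|a| * c) => x; rewrite normrM ler_wpM2l.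
Qed.

Lemma bmeas_cst c : bmeas (fun=> c).
Proof. by split => //; exists `|c|. Qed.

Lemma bmeas_fdiff h u : bmeas u -> bmeas (fdiff h u).
Proof. by move=> bu; apply: bmeasB => //; exact: bmeas_shift. Qed.

(** The expectation of [u (x + Y)] for [Y] of law [mu], that is, convolution with the reflected
    measure. *)
Definition convm mu u : 'rV[R]_n -> R := fun x => (\int[mu]_y u (x + y))%R.

Lemma bmeas_integrable mu u x : bmeas u -> mu.-integrable setT (EFin \o (fun y => u (x + y))).
Proof.
move=> /(@bmeas_shift _ x) -[mh [c uc]].
apply: measurable_bounded_integrable => //.
- by rewrite ltey_eq fin_num_measure.
- by under eq_fun do rewrite addrC.
- exists c; split; first exact: num_real.
  by move=> e ce y _ /=; rewrite addrC (le_trans (uc y))// ltW.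
Qed.

Lemma convm_EFin mu u x : bmeas u ->
  ((convm mu u x)%:E = \int[mu]_y (u (x + y)%R)%:E)%E.
Proof.
move=> bu; rewrite /convm /Rintegral fineK//.
exact: (integrable_fin_num measurableT (bmeas_integrable mu x bu)).
Qed.

Lemma convmB mu u v : bmeas u -> bmeas v ->
  convm mu (fun x => u x - v x) = (fun x => convm mu u x - convm mu v x).
Proof. by move=> bu bv; apply/funext => x; apply: RintegralB => //; exact: bmeas_integrable. Qed.

Lemma convmZ mu a u : bmeas u -> convm mu (fun x => a * u x) = (fun x => a * convm mu u x).
Proof. by move=> bu; apply/funext => x; apply: RintegralZl => //; exact: bmeas_integrable. Qed.

Lemma convm_cst mu c : convm mu (fun=> c) = fun=> c.
Proof.
apply/funext => x; rewrite /convm Rintegral_cst//.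
by rewrite (_ : _ setT = 1%E) ?mulr1//; exact: (@probability_setT _ _ _ mu).
Qed.

Lemma convm_shift mu u h : convm mu (fun x => u (x + h)) = fun x => convm mu u (x + h).
Proof. by apply/funext => x; rewrite /convm; under eq_Rintegral do rewrite addrAC. Qed.

Lemma convm_fdiff mu u h : bmeas u -> convm mu (fdiff h u) = fdiff h (convm mu u).
Proof.
by move=> bu; rewrite /fdiff convmB ?convm_shift//; exact: bmeas_shift.
Qed.

Lemma convm_le mu u v : bmeas u -> bmeas v -> (forall x, u x <= v x) ->
  forall x, convm mu u x <= convm mu v x.
Proof. by move=> bu bv uv x; apply: le_Rintegral => //; exact: bmeas_integrable. Qed.

Lemma convm_bound mu u c : bmeas u -> (forall x, `|u x| <= c) ->
  forall x, `|convm mu u x| <= c.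
Proof.
move=> bu uc x; rewrite ler_norml.
have ucl y : - c <= u y <= c by rewrite -ler_norml.
have h1 : convm mu (fun=> - c) x <= convm mu u x.
  by apply: convm_le => //[|y]; [exact: bmeas_cst|have /andP[] := ucl y].
have h2 : convm mu u x <= convm mu (fun=> c) x.
  by apply: convm_le => //[|y]; [exact: bmeas_cst|have /andP[] := ucl y].
by rewrite !convm_cst in h1 h2; rewrite h1 h2.
Qed.

Lemma bmeas_convm_ge0 mu u : bmeas u -> (forall x, 0 <= u x) ->
  measurable_fun setT (convm mu u).
Proof.
move=> bu u0; have [mu_ _] := bu.
apply/measurable_EFinP.
have -> : EFin \o convm mu u = fun x => (\int[mu]_y (u (x + y)%R)%:E)%E.
  by apply/funext => x /=; rewrite convm_EFin.
have mD : measurable_fun setT (fun z : 'rV[R]_n * 'rV[R]_n => (u (z.1 + z.2))%:E).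
  apply/measurable_EFinP.
  have ma : measurable_fun setT (fun z : 'rV[R]_n * 'rV[R]_n => z.1 + z.2).
    by apply: measurable_addrV.
  exact: (measurableT_comp mu_ ma).
by apply: (measurable_fun_fubini_tonelli_F _ mD) => z; rewrite lee_fin.
Qed.

(** Tonelli's theorem asks for a nonnegative integrand. Adding a constant provides one; it is
    written as the subtraction of [- c] so that [convmB] undoes it. *)
Lemma bmeas_ge0_shift u : bmeas u -> exists2 c, (forall x, `|u x| <= c) &
  bmeas (fun x => u x - (- c)) /\ forall x, 0 <= u x - (- c).
Proof.
move=> bu; have [_ [c uc]] := bu; exists c => //; split.
  by apply: bmeasB => //; exact: bmeas_cst.
by move=> x; have := uc x; rewrite ler_norml opprK -lerBlDr sub0r => /andP[].
Qed.

Lemma bmeas_convm mu u : bmeas u -> bmeas (convm mu u).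
Proof.
move=> bu; split; last by have [_ [c uc]] := bu; exists c; exact: convm_bound.
have [c uc [bw w0]] := bmeas_ge0_shift bu.
have := bmeas_convm_ge0 mu bw w0.
rewrite convmB ?convm_cst//; last exact: bmeas_cst.
move=> mw; have -> : convm mu u = (fun x => convm mu u x - - c) \+ cst (- c).
  by apply/funext => x /=; rewrite subrK.
exact: measurable_funD.
Qed.

(** The hypothesis says that [rho] is the law of the sum of independent variables of laws [mu] and
    [nu]; the identity is Tonelli on the product, for nonnegative functions and then after a shift
    by a constant. *)
Lemma convm_comp mu nu rho u :
  (forall A, measurable A -> rho A = (mu \x nu)%E [set z | A (z.1 + z.2)]) ->
  bmeas u -> convm rho u = convm mu (convm nu u).
Proof.
move=> rhoE.
have ma : measurable_fun setT (fun z : 'rV[R]_n * 'rV[R]_n => z.1 + z.2).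
  by apply: measurable_addrV.
have ge0 w : bmeas w -> (forall x, 0 <= w x) -> convm rho w = convm mu (convm nu w).
  move=> bw w0; apply/funext => x; apply: EFin_inj.
  rewrite convm_EFin// convm_EFin; last exact: bmeas_convm.
  have [mw _] := bmeas_shift x bw.
  have mEw : measurable_fun setT (fun y => (w (x + y))%:E).
    by apply/measurable_EFinP; under eq_fun do rewrite addrC.
  transitivity (\int[pushforward (mu \x nu)%E (fun z => z.1 + z.2)%R]_y (w (x + y)%R)%:E)%E.
    by apply: eq_measure_integral => //= A mA _; exact: rhoE.
  rewrite (ge0_integral_pushforward ma)//; last by move=> y _; rewrite lee_fin.
  rewrite preimage_setT.
  rewrite (fubini_tonelli1 ((fun y => (w (x + y))%:E) \o
    (fun z : 'rV[R]_n * 'rV[R]_n => z.1 + z.2)))//.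
  - apply: eq_integral => y _; rewrite convm_EFin//.
    by apply: eq_integral => z _ /=; rewrite addrA.
  - exact: (measurableT_comp mEw ma).
  - by move=> z /=; rewrite lee_fin.
move=> bu; have [c uc [bw w0]] := bmeas_ge0_shift bu.
have bc : bmeas (fun=> - c) by exact: bmeas_cst.
have := ge0 _ bw w0; rewrite !convmB// ?convm_cst//; last exact: bmeas_convm.
by move=> /funeqP E; apply/funext => x; have := E x; move/addIr.
Qed.

End bounded_measurable.
Arguments bmeas {R n}.

(** * The semigroup property of a Lévy process *)

Section levy_semigroup.
Context (R : realType) (d : nat) (disp : measure_display)
  (Omega : measurableType disp) (P : probability Omega R)
  (X : R -> {RV P >-> 'rV[R]_d}).

Let mX t : measurable_fun setT (X t).
Proof. exact: measurable_funP. Qed.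

Lemma semigroupE t u : bmeas u ->
  semigroup X t u = convm (distribution P (X t)) u.
Proof.
move=> bu; apply/funext => x; rewrite /semigroup unlock; apply: EFin_inj.
have [mu [c uc]] := bmeas_shift x bu.
have mu' : measurable_fun setT (fun y => u (x + y)) by under eq_fun do rewrite addrC.
rewrite convm_EFin// integral_distribution//; last 2 first.
- exact/measurable_EFinP.
- apply: (@measurable_bounded_integrable _ _ _ _ (fun w => u (x + X t w))) => //.
  + by rewrite ltey_eq fin_num_measure.
  + exact: (measurableT_comp mu' (mX t)).
  + exists c; split; first exact: num_real.
    by move=> e ce y _ /=; rewrite addrC (le_trans (uc _))// ltW.
rewrite fineK//; apply: integrable_fin_num => //.
apply: (@measurable_bounded_integrable _ _ _ _ (fun w => u (x + X t w))) => //.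
+ by rewrite ltey_eq fin_num_measure.
+ exact: (measurableT_comp mu' (mX t)).
+ exists c; split; first exact: num_real.
  by move=> e ce y _ /=; rewrite addrC (le_trans (uc _))// ltW.
Qed.

Hypothesis levyX : is_levy X.

(** Independence is stated for infinite strictly increasing sequences of times, so 0, s, s + t is
    prolonged by unit steps; only the first two increments are used. *)
Let tm (s t : R) (k : nat) : R :=
  match k with 0 => 0 | 1 => s | k.+2 => s + t + k%:R end.

(** On rectangles the joint law of the two consecutive increments factorizes by independence and
    stationarity; uniqueness of the product measure extends this to the event that the sum lies in
    [A]. *)
Lemma levy_law_add s t : 0 < s -> 0 < t -> forall A, measurable A ->
  distribution P (X (s + t)) A =
  (distribution P (X s) \x distribution P (X t))%E [set z | A (z.1 + z.2)].
Proof.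
move=> s0 t0 A mA.
pose Y0 := increment X 0 s; pose Y1 := increment X s (s + t).
have mI a b : measurable_fun setT (increment X a b).
  by apply: measurable_addrV => //; apply: measurable_opprV.
have ma : measurable_fun setT (fun z : 'rV[R]_d * 'rV[R]_d => z.1 + z.2).
  by apply: measurable_addrV.
have mY : measurable_fun setT (fun w => (Y0 w, Y1 w)).
  by apply: measurable_fun_pair; exact: mI.
have mB : measurable [set z : 'rV[R]_d * 'rV[R]_d | A (z.1 + z.2)].
  by rewrite -[X in measurable X]setTI; exact: ma.
pose m' : {measure set ('rV[R]_d * 'rV[R]_d) -> \bar R} :=
  measure_function_pushforward__canonical__measure_function_Measure P mY.
rewrite (@product_measure_unique _ _ _ _ _ _ _ m')//; last first.
  move=> B C mB' mC.
  have t00 : 0 <= tm s t 0 by [].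
  have tinc k : tm s t k < tm s t k.+1.
    case: k => [|[|k]] //=; first by rewrite addr0 ltrDl.
    by rewrite ltrD2l ltr_nat.
  have := levy_independent levyX (m := 2) t00 tinc.
  move=> /(_ (fun k => if k == ord0 then B else C)) ind.
  rewrite /m' /= /pushforward.
  transitivity (P [set w | forall k : 'I_2, (if k == ord0 then B else C)
      (increment X (tm s t k) (tm s t k.+1) w)]).
    congr (P _); apply/seteqP; split => w /=.
      move=> [Bw Cw] k; case: (unliftP ord0 k) => [j ->|->] //=.
      by rewrite (ord1 j) /= addr0.
    by move=> Hw; split; [have := Hw ord0|have := Hw (lift ord0 ord0); rewrite /= addr0].
  rewrite ind; last by move=> k; case: ifP.
  rewrite big_ord_recl big_ord1 /= addr0.
  congr (_ * _)%E.
    by rewrite (levy_stationary levyX) ?subr0// ltW.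
  have sst : s <= s + t by rewrite lerDl ltW.
  by rewrite (levy_stationary levyX (ltW s0) sst)// addrAC subrr add0r.
rewrite /m' /= /pushforward /distribution /pushforward.
(* Stationarity from time 0 replaces [X (s + t)] by the increment over [0, s + t], which is the sum
   of [Y0] and [Y1]. *)
have := levy_stationary levyX (lexx 0) (ltW (addr_gt0 s0 t0)) mA.
rewrite subr0 => <-; congr (P _); apply/seteqP.
have YE w : increment X 0 (s + t) w = Y0 w + Y1 w.
  by rewrite /Y0 /Y1 /increment [RHS]addrC subrKA.
by split => w /=; rewrite YE.
Qed.

Lemma semigroupD s t u : 0 < s -> 0 < t -> bmeas u ->
  semigroup X (s + t) u = semigroup X s (semigroup X t u).
Proof.
move=> s0 t0 bu; rewrite (semigroupE _ bu) (semigroupE t bu).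
rewrite semigroupE; last exact: bmeas_convm.
by apply: convm_comp => // A mA; exact: levy_law_add.
Qed.

End levy_semigroup.

(** * Integration against a measure given by a density *)

Section density.
Context (R : realType) (d : measure_display) (T : measurableType d).
Local Open Scope ereal_scope.

(** The given [p] has the same integrals over measurable sets as the Radon-Nikodym derivative, hence
    agrees with it almost everywhere, and the change of variables for the latter applies. *)
Lemma ge0_integral_density (nu : probability T R)
    (lambda : {sigma_finite_measure set T -> \bar R}) (p : T -> R) (w : T -> \bar R) :
  measurable_fun setT p -> (forall x, (0 <= p x)%R) ->
  (forall A, measurable A -> nu A = \int[lambda]_(x in A) (p x)%:E) ->
  measurable_fun setT w -> (forall x, 0 <= w x) ->
  \int[nu]_x w x = \int[lambda]_x (w x * (p x)%:E).
Proof.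
move=> mp p0 nuE mw w0.
have mpE : measurable_fun setT (EFin \o p) by exact/measurable_EFinP.
have dom : nu `<< lambda.
  apply/null_content_dominatesP => A mA A0; rewrite nuE//.
  by apply: null_set_integral => //; exact: (measurable_funS measurableT).
rewrite -(Radon_Nikodym_SigmaFinite.change_of_variables dom w0)//.
have iRN := Radon_Nikodym_SigmaFinite.f_integrable dom.
have mRN := measurable_int _ iRN.
apply: ae_eq_integral => //; try exact: emeasurable_funM.
apply: ae_eqe_mul2l; apply: integral_ae_eq => // E _ mE.
by rewrite -nuE// (Radon_Nikodym_SigmaFinite.f_integral dom).
Qed.

End density.

(** * The L^1 modulus of continuity of a function along a direction *)

Section directional_modulus.
Context (R : realType) (n : nat).
Implicit Types (p : 'rV[R]_n -> R) (e : 'rV[R]_n).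
Local Notation lam := (lebesgue_rV R n).

Lemma is_derive_line p e (y : 'rV[R]_n) (s : R) : derivable p (y + s *: e) e ->
  is_derive s (1 : R) (fun r : R => p (y + r *: e)) ('D_e p (y + s *: e)).
Proof.
move=> dp.
have E : (fun h : R => h^-1 *: (((fun r : R => p (y + r *: e)) \o shift s) (h *: (1 : R))
      - p (y + s *: e))) =
    (fun h => h^-1 *: ((p \o shift (y + s *: e)) (h *: e) - p (y + s *: e))).
  apply/funext => h /=; congr (_ *: (p _ - _)).
  by rewrite /GRing.scale /= mulr1 -/(GRing.scale _ _) scalerDl addrCA addrA.
by split; rewrite /derivable /derive E.
Qed.

Lemma directional_FTC_le p e (y : 'rV[R]_n) (h : R) : 0 < h ->
  (forall x, derivable p x e) -> continuous ('D_e p) ->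
  (`|p (y + h *: e) - p y|%:E <=
    \int[@lebesgue_measure R]_(s in `[0%R, h]) `|'D_e p (y + s *: e)|%:E)%E.
Proof.
move=> h0 dp cp.
pose phi s := p (y + s *: e); pose g s := 'D_e p (y + s *: e).
have dphi s : is_derive s (1 : R) phi (g s) by exact: is_derive_line.
have line_cont : continuous (fun s : R => y + s *: e).
  move=> s; apply: cvgD; first exact: cvg_cst.
  by apply: cvgZr_tmp; exact: cvg_id.
have cg : continuous g.
  move=> s; apply: (@continuous_comp _ _ _ (fun s : R => y + s *: e) ('D_e p)).
    exact: line_cont.
  exact: cp.
have cphi : continuous phi.
  move=> s; apply: differentiable_continuous; apply/derivable1_diffP.
  by have [] := dphi s.
have ig : lebesgue_measure.-integrable `[0, h]%classic (EFin \o g).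
  apply: continuous_compact_integrable; first exact: segment_compact.
  exact: continuous_subspaceT.
have := @continuous_FTC2 _ g phi 0 h h0.
have -> : p y = phi 0 by rewrite /phi scale0r addr0.
rewrite -[p _]/(phi h) => FTC.
rewrite -abse_EFin EFinB -FTC.
- by apply: le_abse_integral => //; exact: measurable_int ig.
- exact: continuous_subspaceT.
- split; first by move=> x _; have [] := dphi x.
  + by apply: cvg_at_right_filter; exact: cphi.
  + by apply: cvg_at_left_filter; exact: cphi.
- by move=> x _; rewrite derive1E; have [_] := dphi x.
Qed.

(** The increment is at most the integral of the directional derivative along the segment. After
    Tonelli, translation invariance makes the integral over space independent of the position on the
    segment, whose length gives the factor [h]. *)
Lemma integral_directional_modulus_gt0 p e (h : R) : 0 < h ->
  (forall x, derivable p x e) -> continuous p -> continuous ('D_e p) ->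
  (\int[lam]_y `|p (y + h *: e) - p y|%:E <= h%:E * \int[lam]_y `|'D_e p y|%:E)%E.
Proof.
move=> h0 dp cp cDp.
have mDp := continuous_measurable_rV cDp; have mp := continuous_measurable_rV cp.
have mabs : measurable_fun setT (fun y => `|'D_e p y|%:E).
  by apply/measurable_EFinP; exact: measurableT_comp.
(* The indicator turns the integral over [0, h] into one over the whole line, so that Tonelli
   applies to the full product. *)
pose F (z : 'rV[R]_n * measurableTypeR R) : \bar R :=
  (`|'D_e p (z.1 + z.2 *: e)|%:E * (\1_(`[0%R, h]%classic) z.2)%:E)%E.
have mline : measurable_fun setT
    (fun z : 'rV[R]_n * measurableTypeR R => z.1 + z.2 *: e).
  by apply: measurable_addrV => //; apply: measurable_scalerV; exact: measurable_snd.
have mF : measurable_fun setT F.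
  apply: emeasurable_funM; first exact: (measurableT_comp mabs mline).
  apply/measurable_EFinP; apply: (measurableT_comp _ measurable_snd).
  exact: measurable_indic.
have F0 z : (0 <= F z)%E by rewrite mule_ge0// lee_fin.
have mmod : measurable_fun setT (fun y : 'rV[R]_n => `|p (y + h *: e) - p y|%:E).
  apply/measurable_EFinP; apply: measurableT_comp => //; apply: measurable_funB => //.
  have mD : measurable_fun setT (fun y : 'rV[R]_n => y + h *: e).
    exact: measurable_addrV.
  exact: (measurableT_comp mp mD).
apply: (@le_trans _ _ (\int[lam]_y \int[@lebesgue_measure R]_s F (y, s))%E).
  apply: ge0_le_integral => //.
  - exact: (measurable_fun_fubini_tonelli_F F mF F0).
  - move=> y _; apply: (le_trans (directional_FTC_le y h0 dp cDp)).
    rewrite integral_mkcond le_eqVlt; apply/orP; left; apply/eqP.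
    apply: eq_integral => s _; rewrite /F patchE /= indicE.
    by case: ifP => sh; rewrite ?mule1 ?mule0.
rewrite (fubini_tonelli F)//.
have E s : (\int[lam]_y F (y, s) =
    (\int[lam]_y `|'D_e p y|%:E) * (\1_(`[0%R, h]%classic) s)%:E)%E.
  rewrite -(ge0_integral_lebesgue_rVD (s *: e) mabs); last by move=> x; rewrite lee_fin.
  rewrite muleC -ge0_integralZl_EFin//.
    by apply: eq_integral => y _; rewrite /F /= muleC.
  have mD : measurable_fun setT (fun y : 'rV[R]_n => y + s *: e).
    exact: measurable_addrV.
  exact: (measurableT_comp mabs mD).
under eq_integral do rewrite E.
rewrite ge0_integralZl//.
- rewrite integral_indic// setIT.
  have lh : @lebesgue_measure R `[0, h]%classic = h%:E.
    by rewrite lebesgue_measure_itv/= lte_fin h0 -EFinB subr0.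
  by rewrite muleC -lh; exact: lexx.
- by apply/measurable_EFinP; exact: measurable_indic.
- by apply: integral_ge0 => y _; rewrite lee_fin.
Qed.

Lemma integral_directional_modulus p e (h : R) :
  (forall x, derivable p x e) -> continuous p -> continuous ('D_e p) ->
  (\int[lam]_y `|p (y + h *: e) - p y|%:E <= `|h|%:E * \int[lam]_y `|'D_e p y|%:E)%E.
Proof.
move=> dp cp cDp; have mp := continuous_measurable_rV cp.
have [h0|h0|->] := ltgtP h 0; last 2 first.
- by rewrite gtr0_norm//; exact: integral_directional_modulus_gt0.
- rewrite normr0 mul0e; under eq_integral do rewrite scale0r addr0 subrr normr0.
  by rewrite integral0.
rewrite ltr0_norm//.
have mmod : measurable_fun setT (fun y : 'rV[R]_n => `|p (y + h *: e) - p y|%:E).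
  apply/measurable_EFinP; apply: measurableT_comp => //; apply: measurable_funB => //.
  have mD : measurable_fun setT (fun y : 'rV[R]_n => y + h *: e).
    exact: measurable_addrV.
  exact: (measurableT_comp mp mD).
(* For negative [h], translating by [- (h *: e)] exchanges the two endpoints and reduces to the step
   [- h]. *)
rewrite -(ge0_integral_lebesgue_rVD (- (h *: e)) mmod); last by move=> y; rewrite lee_fin.
have := @integral_directional_modulus_gt0 p e (- h).
rewrite oppr_gt0 => /(_ h0 dp cp cDp); apply: le_trans.
rewrite le_eqVlt; apply/orP; left; apply/eqP; apply: eq_integral => y _.
by rewrite subrK distrC scaleNr.
Qed.

End directional_modulus.

(** * From the L^1 bound on the density to a Lipschitz bound on averages *)

Section smoothing.
Context (R : realType) (n : nat) (mu : probability 'rV[R]_n R) (p : 'rV[R]_n -> R).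
Local Notation lam := (lebesgue_rV R n).
Hypothesis p_ge0 : forall x, 0 <= p x.
Hypothesis p_cont : continuous p.
Hypothesis muE : forall A, measurable A -> (mu A = \int[lam]_(x in A) (p x)%:E)%E.

Let mp : measurable_fun setT p. Proof. exact: continuous_measurable_rV. Qed.

(** A change of variable moves the shift from [w] to the density, and [w <= C] leaves the L^1
    modulus of [p]. The one-sided form avoids subtracting extended reals. *)
Lemma convm_shift_le (w : 'rV[R]_n -> R) (C : R) (v x : 'rV[R]_n) :
  measurable_fun setT w -> (forall y, 0 <= w y <= C) ->
  ((convm mu w (x + v))%:E <= (convm mu w x)%:E +
     C%:E * \int[lam]_y `|p (y - v) - p y|%:E)%E.
Proof.
move=> mw wC.
have C0 : 0 <= C by have /andP[] := wC 0; exact: le_trans.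
have bw : bmeas w.
  by split => //; exists C => y; have /andP[w0 ?] := wC y; rewrite ger0_norm.
have mD (z : 'rV[R]_n) : measurable_fun setT (fun y : 'rV[R]_n => y + z).
  exact: measurable_addrV.
have mwD z : measurable_fun setT (fun y : 'rV[R]_n => (w (z + y))%:E).
  by apply/measurable_EFinP; under eq_fun do rewrite addrC; exact: (measurableT_comp mw (mD z)).
have mpE : measurable_fun setT (fun y => (p y)%:E) by exact/measurable_EFinP.
have mpD z : measurable_fun setT (fun y : 'rV[R]_n => (p (y - z))%:E).
  by apply/measurable_EFinP; exact: (measurableT_comp mp (mD (- z))).
have mabs : measurable_fun setT (fun y : 'rV[R]_n => `|p (y - v) - p y|%:E).
  apply/measurable_EFinP; apply: measurableT_comp => //; apply: measurable_funB => //.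
  exact: (measurableT_comp mp (mD (- v))).
rewrite !convm_EFin// !(ge0_integral_density mp p_ge0 muE) //; try by
  move=> y; rewrite lee_fin; have /andP[] := wC (x + y); have /andP[] := wC (x + v + y).
have -> : (\int[lam]_y ((w (x + v + y))%:E * (p y)%:E) =
    \int[lam]_y ((w (x + y))%:E * (p (y - v))%:E))%E.
  rewrite -[RHS](ge0_integral_lebesgue_rVD v).
  - by apply: eq_integral => y _; rewrite addrK (addrC y) addrA.
  - exact: emeasurable_funM.
  - by move=> y; rewrite mule_ge0 ?lee_fin//; have /andP[] := wC (x + y).
rewrite -ge0_integralZl_EFin//.
rewrite -ge0_integralD//.
- apply: ge0_le_integral => //.
  + by move=> y _; rewrite mule_ge0 ?lee_fin//; have /andP[] := wC (x + y).
  + exact: emeasurable_funM.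
  + by apply: emeasurable_funD; apply: emeasurable_funM.
  + move=> y _; rewrite -!EFinM -EFinD lee_fin -lerBlDl -mulrBr.
    have /andP[w0 w1] := wC (x + y).
    apply: (le_trans (ler_norm _)); rewrite normrM (ger0_norm w0).
    by rewrite ler_wpM2r.
- by move=> y _; rewrite mule_ge0 ?lee_fin//; have /andP[] := wC (x + y).
- exact: emeasurable_funM.
- by move=> y _; rewrite mule_ge0 ?lee_fin.
- exact: emeasurable_funM.
Qed.

(** The factor [2 * c] is the range of [u + c], the nonnegative function to which the one-sided
    inequality is applied. *)
Lemma convm_lipschitz_dir (u : 'rV[R]_n -> R) (c K : R) (e : 'rV[R]_n) :
  bmeas u -> (forall x, `|u x| <= c) ->
  (forall x, derivable p x e) -> continuous ('D_e p) ->
  (\int[lam]_y `|'D_e p y|%:E <= K%:E)%E ->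
  forall x h, `|convm mu u (x + h *: e) - convm mu u x| <= `|h| * (2 * c * K).
Proof.
move=> bu uc dp cDp pK.
have c0 : 0 <= c by exact: le_trans (uc 0).
pose w x := u x - (- c).
have bc : bmeas (fun _ : 'rV[R]_n => - c) by exact: bmeas_cst.
have wC y : 0 <= w y <= 2 * c.
  by have := uc y; rewrite ler_norml /w => /andP[? ?]; apply/andP; split; lra.
have mw : measurable_fun setT w by have [] := bmeasB bu bc.
have step x h : convm mu u (x + h *: e) <= convm mu u x + `|h| * (2 * c * K).
  have := convm_shift_le (h *: e) x mw wC.
  have /funeqP E := convmB mu bu bc; rewrite !E convm_cst.
  rewrite [X in (_ * X)%E](_ : _ = \int[lam]_y `|p (y + (- h) *: e) - p y|%:E)%E; last first.
    by under [RHS]eq_integral do rewrite scaleNr.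
  move=> H; have := le_trans H (leeD (lexx _) (lee_wpmul2l _
    (integral_directional_modulus (- h) dp p_cont cDp))).
  rewrite lee_fin => /(_ (mulr_ge0 (ler0n _ 2) c0)) {}H.
  have hK : (`|- h|%:E * \int[lam]_y `|'D_e p y|%:E <= `|h|%:E * K%:E)%E.
    by rewrite normrN; apply: lee_wpmul2l => //; rewrite lee_fin.
  have := le_trans H (leeD (lexx _) (lee_wpmul2l _ hK)).
  rewrite lee_fin => /(_ (mulr_ge0 (ler0n _ 2) c0)).
  rewrite -!EFinM -EFinD lee_fin.
  have -> : 2 * c * (`|h| * K) = `|h| * (2 * c * K) by ring.
  by lra.
move=> x h; rewrite ler_norml; apply/andP; split; last first.
  by rewrite lerBlDl; exact: step.
(* The lower bound is the upper bound read from the other endpoint. *)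
have := step (x + h *: e) (- h).
by rewrite scaleNr addrK normrN; lra.
Qed.

Lemma ler_coord_enorm (h : 'rV[R]_n) i : `|h ord0 i| <= enorm h.
Proof.
rewrite -sqrtr_sqr ler_wsqrtr// /dot (bigD1 i)//= -expr2 lerDl.
by apply: sumr_ge0 => j _; rewrite -expr2 sqr_ge0.
Qed.

(** The path from [x] to [x + h] changes one coordinate at a time; each move is at most [enorm h]
    long, whence the factor [n]. *)
Lemma lipschitz_of_coordinates (v : 'rV[R]_n -> R) (L : R) : 0 <= L ->
  (forall i x h, `|v (x + h *: delta_mx ord0 i) - v x| <= `|h| * L) ->
  forall x h, `|v (x + h) - v x| <= n%:R * enorm h * L.
Proof.
move=> L0 vL x h.
rewrite {1}[h]row_sum_delta.
have H (r : seq 'I_n) y : `|v (y + \sum_(i <- r) h 0 i *: delta_mx 0 i) - v y| <=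
    \sum_(i <- r) `|h 0 i| * L.
  elim: r y => [|i r IH] y; first by rewrite !big_nil addr0 subrr normr0.
  rewrite !big_cons addrA.
  rewrite -(subrKA (v (y + h 0 i *: delta_mx 0 i))) [leRHS]addrC.
  by apply: le_trans (ler_normD _ _) _; rewrite lerD//; exact: vL.
apply: (le_trans (H _ _)).
apply: (@le_trans _ _ (\sum_(i < n) enorm h * L)).
  by apply: ler_sum => i _; rewrite ler_wpM2r// ler_coord_enorm.
by rewrite sumr_const card_ord -[X in X <= _]mulr_natl mulrA.
Qed.

End smoothing.

(** * Iterated differences and Marchaud's inequality *)

Section finite_differences.
Context (R : realType) (n : nat).
Implicit Types (u v : 'rV[R]_n -> R) (h x : 'rV[R]_n).

Lemma fdiffB h u v : fdiff h (fun x => u x - v x) = fun x => fdiff h u x - fdiff h v x.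
Proof. by apply/funext => x; rewrite /fdiff; ring. Qed.

Lemma fdiffD h u v : fdiff h (fun x => u x + v x) = fun x => fdiff h u x + fdiff h v x.
Proof. by apply/funext => x; rewrite /fdiff; ring. Qed.

Lemma fdiffZ h (a : R) u : fdiff h (fun x => a * u x) = fun x => a * fdiff h u x.
Proof. by apply/funext => x; rewrite /fdiff; ring. Qed.

Lemma iter_fdiffB k h u v : iter k (fdiff h) (fun x => u x - v x) =
  fun x => iter k (fdiff h) u x - iter k (fdiff h) v x.
Proof. by elim: k => // k IH; rewrite iterS IH fdiffB. Qed.

Lemma iter_fdiffD k h u v : iter k (fdiff h) (fun x => u x + v x) =
  fun x => iter k (fdiff h) u x + iter k (fdiff h) v x.
Proof. by elim: k => // k IH; rewrite iterS IH fdiffD. Qed.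

Lemma iter_fdiffZ k h (a : R) u : iter k (fdiff h) (fun x => a * u x) =
  fun x => a * iter k (fdiff h) u x.
Proof. by elim: k => // k IH; rewrite iterS IH fdiffZ. Qed.

Lemma iter_fdiff_bound k h u (c : R) : (forall x, `|u x| <= c) ->
  forall x, `|iter k (fdiff h) u x| <= 2 ^+ k * c.
Proof.
move=> uc; elim: k => [|k IH] x; first by rewrite expr0 mul1r.
rewrite iterS exprS -mulrA mulr2n mulrDl mul1r /fdiff.
by rewrite (le_trans (ler_normB _ _))// lerD.
Qed.

Lemma bmeas_iter_fdiff k h u : bmeas u -> bmeas (iter k (fdiff h) u).
Proof. by move=> bu; elim: k => // k IH; rewrite iterS; exact: bmeas_fdiff. Qed.

Lemma dotZ (a : R) h : dot (a *: h) (a *: h) = a ^+ 2 * dot h h.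
Proof. by rewrite /dot mulr_sumr; apply: eq_bigr => i _; rewrite !mxE; ring. Qed.

Lemma dot_ge0 h : 0 <= dot h h.
Proof. by apply: sumr_ge0 => i _; rewrite -expr2 sqr_ge0. Qed.

Lemma enorm_ge0 h : 0 <= enorm h. Proof. exact: sqrtr_ge0. Qed.

Lemma enormZ (a : R) h : enorm (a *: h) = `|a| * enorm h.
Proof. by rewrite /enorm dotZ sqrtrM ?sqr_ge0// sqrtr_sqr. Qed.

Lemma enorm_gt0 h : h != 0 -> 0 < enorm h.
Proof.
move=> h0; rewrite lt_neqAle enorm_ge0 andbT eq_sym.
apply: contra h0 => /eqP h0; apply/eqP/rowP => i; rewrite mxE.
by apply/normr0_eq0/le_anti; rewrite normr_ge0 andbT -h0 ler_coord_enorm.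
Qed.

(** The operator [E + 1], where [E] is translation by [h]. *)
Let avg2 h u x := u x + u (x + h).

Let fdiff_double h u : fdiff (h + h) u = fdiff h (avg2 h u).
Proof. by apply/funext => x; rewrite /fdiff /avg2 !addrA; ring. Qed.

Let avg2_fdiff h u : avg2 h (fdiff h u) = fdiff h (avg2 h u).
Proof. by apply/funext => x; rewrite /fdiff /avg2; ring. Qed.

Let avg2_iter_fdiff k h u : avg2 h (iter k (fdiff h) u) = iter k (fdiff h) (avg2 h u).
Proof. by elim: k => // k IH; rewrite !iterS -IH avg2_fdiff. Qed.

(* [E^2 - 1 = (E - 1)(E + 1)] for the translation [E] by [h]: the double step is
   compared with [2^k] times the simple one by replacing each factor [E + 1] by
   [2], the error being of order one higher. *)
Lemma iter_fdiff_double_le k h u (S : R) :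
  (forall x, `|iter k.+1 (fdiff h) u x| <= S) ->
  forall x, `|iter k (fdiff (h + h)) u x - 2 ^+ k * iter k (fdiff h) u x| <=
    k%:R * 2 ^+ k * S.
Proof.
move=> uS; have S0 : 0 <= S by exact: le_trans (uS 0).
have avg2_iter i v : fdiff h (iter i (avg2 h) v) = iter i (avg2 h) (fdiff h v).
  by elim: i v => // i IH v; rewrite iterS -avg2_fdiff IH.
have dbl i v : iter i (fdiff (h + h)) v = iter i (fdiff h) (iter i (avg2 h) v).
  elim: i v => // i IH v.
  by rewrite [in LHS]iterSr IH fdiff_double -avg2_iter [RHS]iterSr [in RHS]iterSr.
have H i x : `|iter k (fdiff h) (iter i (avg2 h) u) x - 2 ^+ i * iter k (fdiff h) u x| <=
    i%:R * 2 ^+ i * S.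
  elim: i x => [|i IH] x; first by rewrite expr0 mul1r subrr normr0 mul0r mul0r.
  rewrite iterS -avg2_iter_fdiff /avg2.
  set v := iter k (fdiff h) (iter i (avg2 h) u); set w := iter k (fdiff h) u.
  have -> : v x + v (x + h) - 2 ^+ i.+1 * w x =
    (v x - 2 ^+ i * w x) + (v (x + h) - 2 ^+ i * w (x + h)) +
      2 ^+ i * (fdiff h w x) by rewrite /fdiff exprS; ring.
  have n2 : 0 < (2 : R) ^+ i by rewrite exprn_gt0.
  have h1 := IH x; have h2 := IH (x + h).
  have h3 : `|2 ^+ i * fdiff h w x| <= 2 ^+ i * S.
    by rewrite normrM (gtr0_norm n2) ler_pM2l//; exact: uS.
  have := ler_normD (v x - 2 ^+ i * w x) (v (x + h) - 2 ^+ i * w (x + h)).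
  have := ler_normD ((v x - 2 ^+ i * w x) + (v (x + h) - 2 ^+ i * w (x + h)))
    (2 ^+ i * (fdiff h w x)).
  rewrite -/v -/w in h1 h2 *.
  have -> : i.+1%:R * 2 ^+ i.+1 * S = 2 * (i%:R * 2 ^+ i * S) + 2 * (2 ^+ i * S).
    by rewrite exprS -natr1; ring.
  have : 0 <= 2 ^+ i * S by rewrite mulr_ge0// ltW.
  lra.
by move=> x; rewrite dbl; exact: H.
Qed.

(** Doubling the step gives [2^j |D_h^j u| <= |D_2h^j u| + j 2^j C |h|^gamma]. Since [gamma < j],
    passing from [h] to [2h] costs [2^gamma], less than the [2^j] gained, so iterating this
    inequality contracts. *)
Lemma marchaud_step (gamma : R) (j : nat) : 0 <= gamma -> gamma < j%:R ->
  exists2 K : R, 0 <= K & forall u (B C : R), 0 <= C -> (forall x, `|u x| <= B) ->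
    (forall h x, h != 0 -> `|iter j.+1 (fdiff h) u x| <= C * enorm h `^ gamma) ->
    forall h x, h != 0 -> `|iter j (fdiff h) u x| <= K * C * enorm h `^ gamma.
Proof.
move=> g0 gj.
have j0 : (0 < j)%N by rewrite -(ltr_nat R); exact: le_lt_trans gj.
have pj : 0 < (2 : R) ^+ j by rewrite exprn_gt0.
pose q : R := 2 `^ gamma / 2 ^+ j.
have q1 : q < 1.
  rewrite ltr_pdivrMr// mul1r -powR_mulrn//.
  rewrite /powR pnatr_eq0 /= ltr_expR ltr_pM2r// ln_gt0//.
  by rewrite ltr1n.
have q0 : 0 <= q by rewrite divr_ge0// ?powR_ge0// ltW.
(* The fixed point of the recursion: [K = j + q K]. *)
pose K := j%:R / (1 - q).
have K0 : 0 <= K by rewrite divr_ge0// subr_ge0 ltW.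
exists K => // u B C C0 uB uC.
have B0 : 0 <= B by exact: le_trans (uB 0).
pose r : R := (2 ^+ j)^-1.
(* After [N] doublings the trivial bound [2^j B] survives only with the factor [2^(- j N)]; hence
   [B] is absent from the conclusion. *)
have claim N h x : h != 0 ->
    `|iter j (fdiff h) u x| <= K * C * enorm h `^ gamma + r ^+ N * (2 ^+ j * B).
  elim: N h x => [|N IH] h x h0.
    rewrite expr0 mul1r ler_wpDl//; last exact: iter_fdiff_bound.
    by apply: mulr_ge0; [exact: mulr_ge0|exact: powR_ge0].
  have hh0 : h + h != 0.
    by rewrite -mulr2n -scaler_nat scaler_eq0 pnatr_eq0.
  have := IH (h + h) x hh0.
  have -> : enorm (h + h) `^ gamma = 2 `^ gamma * enorm h `^ gamma.
    rewrite -mulr2n -scaler_nat enormZ powRM// ?enorm_ge0//.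
    by rewrite ger0_norm.
  have := iter_fdiff_double_le (uC h ^~ h0) x.
  set a := iter j (fdiff (h + h)) u x; set b := iter j (fdiff h) u x.
  set e := enorm h `^ gamma; move=> h1 h2.
  have e0 : 0 <= e by exact: powR_ge0.
  have h3 : 2 ^+ j * `|b| <= `|a| + j%:R * 2 ^+ j * (C * e).
    rewrite -{1}(gtr0_norm pj) -normrM.
    have := ler_normB a (a - 2 ^+ j * b); rewrite opprB addrC subrK.
    by move/le_trans; apply; rewrite lerD2l.
  rewrite -(ler_pM2l pj); apply: (le_trans h3).
  have -> : j%:R * 2 ^+ j * (C * e) = 2 ^+ j * (K * (1 - q)) * (C * e).
    by rewrite /K divfK ?gt_eqF ?subr_gt0//; ring.
  have -> : 2 ^+ j * (K * C * e + r ^+ N.+1 * (2 ^+ j * B)) =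
     2 ^+ j * (K * C * e) + (2 ^+ j * r) * r ^+ N * (2 ^+ j * B) by rewrite exprS; ring.
  have -> : 2 ^+ j * r = 1 by rewrite divff// gt_eqF.
  have h4 : K * C * (2 `^ gamma * e) = 2 ^+ j * q * (K * C * e).
    have -> : 2 ^+ j * q = 2 `^ gamma by rewrite mulrC divfK// gt_eqF.
    by ring.
  rewrite h4 in h2.
  have -> : 2 ^+ j * (K * (1 - q)) * (C * e) =
    2 ^+ j * (K * C * e) - 2 ^+ j * q * (K * C * e) by ring.
  rewrite mul1r; lra.
move=> h x h0.
apply/ler_addgt0Pr => e e0.
have r0 : 0 < r by rewrite invr_gt0.
have r1 : r < 1.
  by rewrite invf_lt1// exprn_egt1// ?ltr1n// -lt0n.
have lim0 : r ^+ N * (2 ^+ j * B) @[N --> \oo] --> (0 : R).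
  rewrite -[X in _ --> X](mul0r (2 ^+ j * B)); apply: cvgM; last exact: cvg_cst.
  by apply: cvg_expr; rewrite gtr0_norm.
move/cvgrPdist_lt : lim0 => /(_ _ e0) [N _ /(_ N (leqnn N))].
rewrite /= sub0r normrN => hN.
apply: (le_trans (claim N h x h0)); rewrite lerD2l.
by apply: (le_trans (ler_norm _)); exact: ltW.
Qed.

Lemma marchaud (gamma : R) (j k : nat) : 0 <= gamma -> gamma < j%:R ->
  exists2 K : R, 0 <= K & forall u (B C : R), 0 <= C -> (forall x, `|u x| <= B) ->
    (forall h x, h != 0 -> `|iter (k + j) (fdiff h) u x| <= C * enorm h `^ gamma) ->
    forall h x, h != 0 -> `|iter j (fdiff h) u x| <= K * C * enorm h `^ gamma.
Proof.
move=> g0 gj; elim: k => [|k [K K0 IH]].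
  by exists 1 => // u B C _ _ H h x h0; rewrite mul1r; exact: H.
have gkj : gamma < (k + j)%:R by rewrite (lt_le_trans gj)// ler_nat leq_addl.
have [K' K'0 step] := marchaud_step g0 gkj.
exists (K * K'); first exact: mulr_ge0.
move=> u B C C0 uB uC h x h0; rewrite -[K * K' * C]mulrA.
by apply: (IH u B) => //; [exact: mulr_ge0|exact: (step u B)].
Qed.

End finite_differences.

(** * Elementary bounds on exponentials and powers *)

Section exponential_bounds.
Context (R : realType).

(** From [e^(-x) >= 1 - x] one gets [(1 - x) e^x <= 1], so the remainder is at most [x^2 / (1 - x)],
    and [1 - x >= 1/2]. *)
Lemma expRB1x_le (x : R) : `|x| <= 2^-1 -> `|expR x - 1 - x| <= 2 * x ^+ 2.
Proof.
rewrite ler_norml => /andP[x1 x2].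
have h1 := expR_ge1Dx x; have h2 := expR_ge1Dx (- x).
have e0 := expR_gt0 x.
have : (1 - x) * expR x <= 1.
  have := ler_wpM2r (ltW e0) h2; rewrite -expRD addNr expR0.
  by [].
move=> h3; rewrite ger0_norm; last by lra.
nra.
Qed.

Lemma expRB1_le (x : R) : `|x| <= 2^-1 -> `|expR x - 1| <= 2 * `|x|.
Proof.
move=> x1; have h := expRB1x_le x1.
have := ler_normD (expR x - 1 - x) x; rewrite subrK => /le_trans; apply.
have : x ^+ 2 <= 2^-1 * `|x|.
  by rewrite -real_normK ?num_real// expr2 ler_wpM2r.
lra.
Qed.

Lemma powR_ge_expn (x g : R) (k : nat) : 0 < x <= 1 -> g <= k%:R -> x ^+ k <= x `^ g.
Proof.
by move=> x01 gk; rewrite -powR_mulrn ?ger_powR//; case/andP: x01 => /ltW.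
Qed.

End exponential_bounds.

(** * Differences under an abstract smoothing semigroup, and the telescoping estimate *)

Section regularizing_semigroup.
Context (R : realType) (n : nat) (alpha T K : R).
Implicit Types (t s c e a : R) (u v : 'rV[R]_n -> R) (h x : 'rV[R]_n).
Variable S : R -> ('rV[R]_n -> R) -> 'rV[R]_n -> R.
Hypothesis alpha_gt0 : 0 < alpha.
Hypothesis alpha_le2 : alpha <= 2.
Hypothesis T_gt0 : 0 < T.
Hypothesis K_ge0 : 0 <= K.
Hypothesis S_bmeas : forall t u, 0 < t -> bmeas u -> bmeas (S t u).
Hypothesis S_bound : forall t u c, 0 < t -> bmeas u -> (forall x, `|u x| <= c) ->
  forall x, `|S t u x| <= c.
Hypothesis SB : forall t u v, 0 < t -> bmeas u -> bmeas v ->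
  S t (fun x => u x - v x) = fun x => S t u x - S t v x.
Hypothesis SZ : forall t a u, 0 < t -> bmeas u ->
  S t (fun x => a * u x) = fun x => a * S t u x.
Hypothesis S_fdiff : forall t h u, 0 < t -> bmeas u ->
  S t (fdiff h u) = fdiff h (S t u).
Hypothesis S_add : forall s t u, 0 < s -> 0 < t -> bmeas u ->
  S (s + t) u = S s (S t u).
Hypothesis S_smooth : forall t h u c, 0 < t -> t <= T -> bmeas u ->
  (forall x, `|u x| <= c) ->
  forall x, `|fdiff h (S t u) x| <= K * enorm h * t `^ (- alpha^-1) * c.

Lemma S_iter_fdiff t h u k : 0 < t -> bmeas u ->
  S t (iter k (fdiff h) u) = iter k (fdiff h) (S t u).
Proof.
move=> t0 bu; elim: k => // k IH; rewrite !iterS -IH S_fdiff//.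
exact: bmeas_iter_fdiff.
Qed.

Lemma bmeas_iter_S t u k : 0 < t -> bmeas u -> bmeas (iter k (S t) u).
Proof. by move=> t0 bu; elim: k => // k IH; rewrite iterS; exact: S_bmeas. Qed.

Lemma iter_S t u k : 0 < t -> bmeas u -> iter k.+1 (S t) u = S (k.+1%:R * t) u.
Proof.
move=> t0 bu; elim: k => [|k IH]; first by rewrite mul1r.
rewrite iterS IH -S_add ?mulr_gt0//; congr (S _ u).
by rewrite -[k.+2%:R]natr1; ring.
Qed.

Lemma iter_S_bound t u k c : 0 < t -> bmeas u -> (forall x, `|u x| <= c) ->
  forall x, `|iter k (S t) u x| <= c.
Proof.
move=> t0 bu uc; elim: k => // k IH; rewrite iterS.
by apply: S_bound => //; exact: bmeas_iter_S.
Qed.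

(** As [S t] commutes with differences, each of the [k] differences can be paired with its own
    factor [S t]. *)
Lemma iter_fdiff_iter_S_le t h u c k : 0 < t -> t <= T -> bmeas u -> (forall x, `|u x| <= c) ->
  forall x, `|iter k (fdiff h) (iter k (S t) u) x| <=
    (K * enorm h * t `^ (- alpha^-1)) ^+ k * c.
Proof.
move=> t0 tT bu uc; elim: k => [|k IH]; first by move=> x; rewrite expr0 mul1r.
have b := bmeas_iter_S k t0 bu.
move=> x; rewrite [iter k.+1 (S t) u]iterS iterS -S_iter_fdiff// exprS -mulrA.
by apply: S_smooth => //; exact: bmeas_iter_fdiff.
Qed.

Lemma iter_fdiff_S_le t h u c k : 0 < t -> t <= T -> bmeas u -> (forall x, `|u x| <= c) ->
  forall x, `|iter k.+1 (fdiff h) (S t u) x| <=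
    (K * enorm h * (t / k.+1%:R) `^ (- alpha^-1)) ^+ k.+1 * c.
Proof.
move=> t0 tT bu uc x.
have tk0 : 0 < t / k.+1%:R by rewrite divr_gt0.
have tkT : t / k.+1%:R <= T.
  have k1 : 1 <= k.+1%:R :> R by rewrite ler1n.
  by rewrite ler_pdivrMr//; nra.
have := iter_fdiff_iter_S_le h k.+1 tk0 tkT bu uc x.
by rewrite iter_S// mulrC divfK// pnatr_eq0.
Qed.

(* [400 = 2^4 * 5^2] serves for [t < 4 |h|^alpha], where differences are bounded
   trivially, and [25 K^4] for larger [t]. *)
Let C0 : R := 400 + 25 * K ^+ 4.

Let C0_ge0 : 0 <= C0. Proof.
apply: addr_ge0; first exact: ler0n.
by apply: mulr_ge0; [exact: ler0n|exact: exprn_ge0].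
Qed.

(** Below [t = 4 a] the ratio [a / (a + t)] is at least 1/5, so the trivial factor [2^4] suffices.
    Above it, [4 a / t <= 1] and [4 / alpha >= 2] bound the smoothing factor by [(4 a / t)^2], and
    [4 a / t <= 5 a / (a + t)] holds exactly from [t = 4 a] on. *)
Lemma fdiff4_S_le t h u c : 0 < t -> t <= T -> h != 0 -> bmeas u ->
  (forall x, `|u x| <= c) ->
  forall x, `|iter 4 (fdiff h) (S t u) x| <=
    C0 * (enorm h `^ alpha / (enorm h `^ alpha + t)) ^+ 2 * c.
Proof.
move=> t0 tT h0 bu uc x.
have c0 : 0 <= c by exact: le_trans (uc 0).
set a := enorm h `^ alpha.
have a0 : 0 < a by rewrite powR_gt0// enorm_gt0.
have at0 : 0 < a + t by rewrite addr_gt0.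
have [ta|ta] := ltP t (4 * a).
  have q5 : 5^-1 <= a / (a + t).
    by rewrite ler_pdivlMr// mulrC ler_pdivrMr//; lra.
  apply: (@le_trans _ _ (2 ^+ 4 * c)); last first.
    rewrite ler_wpM2r//; have : 25^-1 <= (a / (a + t)) ^+ 2.
      by apply: (@le_trans _ _ (5^-1 ^+ 2)); [lra|rewrite lerXn2r// nnegrE; lra].
    have : 0 <= K ^+ 4 by rewrite exprn_ge0.
    rewrite /C0; set z := (a / (a + t)) ^+ 2; set y := K ^+ 4; nra.
  by apply: iter_fdiff_bound; exact: S_bound.
have := iter_fdiff_S_le h 3 t0 tT bu uc x; move=> /le_trans; apply.
rewrite ler_wpM2r// -mulrA exprMn.
have y4 : (enorm h * (t / 4) `^ (- alpha^-1)) ^+ 4 <= (4 * a / t) ^+ 2.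
  set z := 4 * a / t.
  have z0 : 0 < z by rewrite divr_gt0// mulr_gt0.
  have z1 : z <= 1 by rewrite ler_pdivrMr// mul1r.
  have -> : enorm h * (t / 4) `^ (- alpha^-1) = z `^ alpha^-1.
    rewrite /z (_ : 4 * a / t = a * (t / 4)^-1); last by rewrite invf_div; ring.
    have aE : a `^ alpha^-1 = enorm h.
      by rewrite /a -powRrM divff ?gt_eqF// powRr1 ?enorm_ge0.
    have tE : (t / 4)^-1 `^ alpha^-1 = (t / 4) `^ (- alpha^-1).
      by rewrite -[(t / 4)^-1]powR_inv1 ?divr_ge0 ?ltW// -powRrM mulN1r.
    have t40 : 0 <= (t / 4)^-1 by rewrite invr_ge0 divr_ge0// ltW.
    by rewrite (powRM _ (ltW a0) t40) aE tE.
  rewrite -(powR_mulrn 4) ?powR_ge0// -powRrM -(powR_mulrn 2) ?(ltW z0)//.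
  apply: ger_powR; first by rewrite z0.
  have i2 : 2^-1 <= alpha^-1 by rewrite lef_pV2 ?posrE.
  by lra.
have -> : C0 * (a / (a + t)) ^+ 2 = 400 * (a / (a + t)) ^+ 2 + K ^+ 4 * (5 * (a / (a + t))) ^+ 2.
  by rewrite /C0; ring.
have q0 : 0 <= a / (a + t) by rewrite divr_ge0// ltW.
have zq : 4 * a / t <= 5 * (a / (a + t)).
  have h4 : 0 <= a * (t - 4 * a) by rewrite mulr_ge0 ?subr_ge0// ltW.
  by rewrite [5 * _]mulrA ler_pdivrMr// mulrAC ler_pdivlMr//; nra.
apply: ler_wpDl; first by apply: mulr_ge0; [exact: ler0n|exact: exprn_ge0].
apply: ler_wpM2l; first exact: exprn_ge0.
apply: (le_trans y4); rewrite lerXn2r// nnegrE; last by rewrite mulr_ge0.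
by rewrite divr_ge0 ?mulr_ge0// ltW.
Qed.

Variables (f Af g : 'rV[R]_n -> R) (rho delta Bf A0 G : R) (m : nat).
Hypothesis bf : bmeas f.
Hypothesis bAf : bmeas Af.
Hypothesis fB : forall x, `|f x| <= Bf.
Hypothesis AfB : forall x, `|Af x| <= A0.
Hypothesis gE : forall x, Af x + rho * f x = g x.
Hypothesis generator : forall e, 0 < e -> exists2 eta, 0 < eta &
  forall t, 0 < t -> t < eta -> forall x, `|S t f x - f x - t * Af x| <= e * t.
Hypothesis G_ge0 : 0 <= G.
Hypothesis delta_lt : delta < m%:R.
Hypothesis gG : forall h x, h != 0 -> `|iter m (fdiff h) g x| <= G * enorm h `^ delta.

Let bg : bmeas g.
Proof.
have -> : g = fun x => Af x - (- rho) * f x.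
  by apply/funext => x; rewrite -gE mulNr opprK.
by apply: bmeasB => //; exact: bmeasZ.
Qed.

(** The factor [e^(rho t)] absorbs the term [rho * f]: the generator of [Q] maps [f] to [g]
    itself. *)
Let Q t u x := expR (rho * t) * S t u x.

Let Q_bmeas t u : 0 < t -> bmeas u -> bmeas (Q t u).
Proof. by move=> t0 bu; apply: bmeasZ; exact: S_bmeas. Qed.

Let iter_Q t u k : 0 < t -> bmeas u ->
  iter k (Q t) u = fun x => expR (rho * (k%:R * t)) * iter k (S t) u x.
Proof.
move=> t0 bu; elim: k => [|k IH].
  by apply/funext => x; rewrite mul0r mulr0 expR0 mul1r.
rewrite iterS IH /Q SZ//; last exact: bmeas_iter_S.
apply/funext => x; rewrite -iterS mulrA -expRD; congr (expR _ * _).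
by rewrite -[k.+1%:R]natr1; ring.
Qed.

Let E : R := expR (`|rho| * T).

Let expR_le_E s : 0 <= s -> s <= T -> expR (rho * s) <= E.
Proof.
move=> s0 sT; rewrite /E ler_expR (le_trans (ler_norm _))// normrM (ger0_norm s0).
by rewrite ler_wpM2l.
Qed.

Let E_ge1 : 1 <= E.
Proof. by rewrite -expR0 ler_expR mulr_ge0// ltW. Qed.

Lemma discounted_generator e : 0 < e -> exists2 eta, 0 < eta &
  forall t, 0 < t -> t < eta -> forall x, `|Q t f x - f x - t * g x| <= e * t.
Proof.
move=> e0; have e4 : 0 < e / 4 by rewrite divr_gt0.
have [eta eta0 H] := generator e4.
(* The coefficient of [t^2] in the two Taylor errors below. Then [eta2] ensures [|rho t| <= 1/2],
   [eta3] ensures [t L <= e / 2], and [e / 4] leaves room for [e^(rho t) <= 2]. *)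
pose L := 2 * `|rho| * A0 + 2 * rho ^+ 2 * Bf.
have A00 : 0 <= A0 by exact: le_trans (AfB 0).
have Bf0 : 0 <= Bf by exact: le_trans (fB 0).
have L0 : 0 <= L by rewrite addr_ge0// mulr_ge0// mulr_ge0// sqr_ge0.
pose eta2 := (2 * (`|rho| + 1))^-1; pose eta3 := e / (2 * (L + 1)).
have r1 : 0 < `|rho| + 1 by rewrite ltr_wpDl.
have eta20 : 0 < eta2 by rewrite invr_gt0 mulr_gt0.
have eta30 : 0 < eta3 by rewrite divr_gt0// mulr_gt0// ltr_wpDl.
exists (Num.min eta (Num.min eta2 eta3)); first by rewrite !lt_min eta0 eta20.
move=> t t0; rewrite !lt_min => /and3P[t1 t2 t3] x.
have rt : `|rho * t| <= 2^-1.
  rewrite normrM (gtr0_norm t0).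
  have : t * (2 * (`|rho| + 1)) < 1 by rewrite -ltr_pdivlMr ?mulr_gt0// mul1r.
  nra.
have t3' : t * L <= e / 2.
  have : t * (2 * (L + 1)) < e by rewrite -ltr_pdivlMr ?mulr_gt0// ltr_wpDl.
  nra.
have -> : Q t f x - f x - t * g x = expR (rho * t) * (S t f x - f x - t * Af x)
   + (expR (rho * t) - 1) * (t * Af x) + (expR (rho * t) - 1 - rho * t) * f x.
  by rewrite /Q -gE; ring.
have h1 : `|expR (rho * t) * (S t f x - f x - t * Af x)| <= 2 * (e / 4 * t).
  rewrite normrM gtr0_norm ?expR_gt0//; apply: ler_pM => //.
  - have := expRB1_le rt; rewrite ler_norml => /andP[_]; lra.
  - exact: H.
have h2 : `|(expR (rho * t) - 1) * (t * Af x)| <= 2 * (`|rho| * t) * (t * A0).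
  rewrite normrM; apply: ler_pM => //.
    by rewrite -{2}(gtr0_norm t0) -normrM; exact: expRB1_le.
  by rewrite normrM (gtr0_norm t0) ler_pM2l.
have h3 : `|(expR (rho * t) - 1 - rho * t) * f x| <= 2 * (rho * t) ^+ 2 * Bf.
  by rewrite normrM; apply: ler_pM => //; exact: expRB1x_le.
apply: (le_trans (ler_normD _ _)); apply: (le_trans (lerD (ler_normD _ _) (lexx _))).
apply: (le_trans (lerD (lerD h1 h2) h3)).
have -> : 2 * (e / 4 * t) + 2 * (`|rho| * t) * (t * A0) + 2 * (rho * t) ^+ 2 * Bf =
   e / 2 * t + t * L * t by rewrite /L; field.
have -> : e * t = e / 2 * t + e / 2 * t by field.
by rewrite lerD2l ler_wpM2r// ltW.
Qed.

(* [a - a^2 / (a + N t)] is the integral of [a^2 / (a + s)^2] over [0, N t]. *)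
Lemma discounted_telescope h x e (N : nat) (t : R) : h != 0 ->
  0 < t -> t <= enorm h `^ alpha -> N%:R * t <= T ->
  (forall x, `|Q t f x - f x - t * g x| <= e * t) ->
  `|iter (4 + m) (fdiff h) (iter N (Q t) f) x - iter (4 + m) (fdiff h) f x| <=
    2 * E * C0 * G * enorm h `^ delta *
      (enorm h `^ alpha - (enorm h `^ alpha) ^+ 2 / (enorm h `^ alpha + N%:R * t)) +
    N%:R * t * (2 ^+ (4 + m) * E * e).
Proof.
move=> h0 t0 ta.
set a := enorm h `^ alpha; set D := enorm h `^ delta.
have a0 : 0 < a by rewrite powR_gt0// enorm_gt0.
have D0 : 0 <= D by exact: powR_ge0.
move=> + Qe.
have e0 : 0 <= e by have := le_trans (normr_ge0 _) (Qe 0); rewrite pmulr_lge0.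
pose r y := Q t f y - f y - t * g y.
have br : bmeas r by apply: bmeasB; [apply: bmeasB => //; exact: Q_bmeas|exact: bmeasZ].
elim: N => [|N IH] NT.
  by rewrite subrr normr0 mul0r addr0 expr2 mulfK ?gt_eqF// subrr mulr0 mul0r addr0.
have NTT : N%:R * t <= T by apply: le_trans NT; rewrite ler_pM2r// ler_nat.
have Nt0 : 0 <= N%:R * t by rewrite mulr_ge0// ltW.
have aN0 : 0 < a + N%:R * t by rewrite ltr_wpDr.
have aN1 : 0 < a + N.+1%:R * t by rewrite addr_gt0// mulr_gt0.
(* One more step adds [t Q^N g] and a propagated error. Sums are written [u - (-1) * v] because the
   abstract operators are only known to respect differences and multiples. *)
have Qfg : iter N.+1 (Q t) f = fun y =>
    iter N (Q t) f y - (- 1) * (t * iter N (Q t) g y + iter N (Q t) r y).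
  rewrite iterSr !iter_Q//; last exact: Q_bmeas.
  have -> : Q t f = fun y => f y - (- 1) * (t * g y - (- 1) * r y).
    by apply/funext => y; rewrite /r; ring.
  have itB u v : bmeas u -> bmeas v -> iter N (S t) (fun y => u y - (-1) * v y) =
     fun y => iter N (S t) u y - (-1) * iter N (S t) v y.
    move=> bu bv; elim: N {IH NT NTT Nt0 aN0 aN1} => // N IH; rewrite iterS IH SB//.
    - by rewrite SZ//; exact: bmeas_iter_S.
    - exact: bmeas_iter_S.
    - by apply: bmeasZ; exact: bmeas_iter_S.
  have itZ u : bmeas u -> iter N (S t) (fun y => t * u y) =
     fun y => t * iter N (S t) u y.
    move=> bu; elim: N {IH NT NTT Nt0 aN0 aN1 itB} => // N IH; rewrite iterS IH SZ//.
    exact: bmeas_iter_S.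
  rewrite itB//; last by apply: bmeasB; apply: bmeasZ.
  rewrite itB//; last exact: bmeasZ.
  by rewrite itZ//; apply/funext => y; ring.
rewrite Qfg iter_fdiffB iter_fdiffZ iter_fdiffD iter_fdiffZ.
set DN := iter (4 + m) (fdiff h).
have -> : DN (iter N (Q t) f) x -
    -1 * (t * DN (iter N (Q t) g) x + DN (iter N (Q t) r) x) - DN f x =
  (DN (iter N (Q t) f) x - DN f x) + t * DN (iter N (Q t) g) x + DN (iter N (Q t) r) x by ring.
have hr : `|DN (iter N (Q t) r) x| <= t * (2 ^+ (4 + m) * E * e).
  rewrite (_ : t * _ = 2 ^+ (4 + m) * (E * (e * t))); last by ring.
  apply: iter_fdiff_bound => y; rewrite iter_Q// normrM gtr0_norm ?expR_gt0//.
  apply: ler_pM => //.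
    exact: expR_le_E.
  exact: iter_S_bound.
have hg : `|DN (iter N (Q t) g) x| <= E * (C0 * (a / (a + N%:R * t)) ^+ 2 * (G * D)).
  rewrite iter_Q// /DN iter_fdiffZ normrM gtr0_norm ?expR_gt0//.
  apply: ler_pM => //.
    exact: expR_le_E.
  (* At [N = 0] nothing is smoothed yet, but the ratio is then 1 and [C0 >= 2^4] covers the trivial
     bound. *)
  case: N NTT aN0 {IH NT Nt0 aN1 Qfg hr} => [|N] NTT aN0.
    rewrite mul0r addr0 divff ?gt_eqF// expr1n mulr1 iterD.
    apply: (@le_trans _ _ (2 ^+ 4 * (G * D))).
      by apply: iter_fdiff_bound => y; exact: gG.
    rewrite ler_wpM2r// ?mulr_ge0// /C0.
    have : 0 <= K ^+ 4 by rewrite exprn_ge0.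
    lra.
  rewrite iter_S// iterD -S_iter_fdiff ?mulr_gt0//.
  apply: fdiff4_S_le => //; [by rewrite mulr_gt0|exact: bmeas_iter_fdiff|].
  by move=> y; exact: gG.
apply: (le_trans (ler_normD _ _)); apply: (le_trans (lerD (ler_normD _ _) (lexx _))).
(* The summand is the value at the left end of a decreasing function, so it exceeds the increment of
   the primitive. Since [t <= a], [a + (N+1) t <= 2 (a + N t)], and the excess costs at most the
   factor 2. *)
have hg' : `|t * DN (iter N (Q t) g) x| <=
  2 * E * C0 * G * D * (a ^+ 2 / (a + N%:R * t) - a ^+ 2 / (a + N.+1%:R * t)).
  rewrite normrM (gtr0_norm t0).
  apply: (le_trans (ler_wpM2l (ltW t0) hg)).
  have -> : a ^+ 2 / (a + N%:R * t) - a ^+ 2 / (a + N.+1%:R * t) =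
      a ^+ 2 * t / ((a + N%:R * t) * (a + N.+1%:R * t)).
    rewrite -[N.+1%:R]natr1; field.
    by apply/andP; split; apply/negP => /eqP; move: aN0 aN1; rewrite -[N.+1%:R]natr1; lra.
  have -> : t * (E * (C0 * (a / (a + N%:R * t)) ^+ 2 * (G * D))) =
     E * C0 * G * D * (t * (a / (a + N%:R * t)) ^+ 2) by ring.
  have -> : 2 * E * C0 * G * D * (a ^+ 2 * t / ((a + N%:R * t) * (a + N.+1%:R * t))) =
     E * C0 * G * D * (2 * (a ^+ 2 * t / ((a + N%:R * t) * (a + N.+1%:R * t)))) by ring.
  apply: ler_wpM2l; first by rewrite !mulr_ge0// (le_trans _ E_ge1).
  rewrite (_ : t * _ = a ^+ 2 * t * ((a + N%:R * t) ^+ 2)^-1); last first.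
    by rewrite expr_div_n; ring.
  rewrite (_ : 2 * _ = a ^+ 2 * t * (2 / ((a + N%:R * t) * (a + N.+1%:R * t)))); last by ring.
  apply: ler_wpM2l; first by rewrite mulr_ge0 ?sqr_ge0// ltW.
  rewrite ler_pdivlMr ?mulr_gt0// mulrC ler_pdivrMr ?exprn_gt0//.
  have ta' : t <= a by [].
  by rewrite expr2 mulrCA ler_pM2l// -[N.+1%:R]natr1; lra.
apply: (le_trans (lerD (lerD (IH NTT) hg') hr)).
rewrite le_eqVlt; apply/orP; left; apply/eqP.
set y := a ^+ 2 / (a + N.+1%:R * t).
by rewrite -[N.+1%:R]natr1; ring.
Qed.

(** [P_T f] contributes [|h|^(4 + m)], which for [|h| <= 1] is below [|h|^(alpha + delta)] because
    [alpha <= 2] and [delta < m]; the telescoping sum contributes [|h|^delta] times at most [a]. *)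
Lemma fdiff_estimate h x : h != 0 -> enorm h <= 1 ->
  `|iter (4 + m) (fdiff h) f x| <=
    (E * (K * (T / (4 + m)%:R) `^ (- alpha^-1)) ^+ (4 + m) + 2 * E * C0) *
    (G + Bf) * enorm h `^ (alpha + delta).
Proof.
move=> h0 h1; have eh0 := enorm_gt0 h0.
have Bf0 : 0 <= Bf by exact: le_trans (fB 0).
have E0 : 0 < E by exact: lt_le_trans E_ge1.
set a := enorm h `^ alpha; set D := enorm h `^ delta.
have a0 : 0 < a by rewrite powR_gt0.
have D0 : 0 < D by exact: powR_gt0.
have -> : enorm h `^ (alpha + delta) = a * D.
  by rewrite powRD// (gt_eqF eh0) implybT.
set kappa := K * (T / (4 + m)%:R) `^ (- alpha^-1).
have kappa0 : 0 <= kappa by rewrite mulr_ge0// powR_ge0.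
apply/ler_addgt0Pr => e e0.
(* The propagated errors add up to at most [W] times the local error rate, so the rate [e / W]
   leaves [e] in total. *)
pose W := T * (2 ^+ (4 + m) * E).
have p2 : 0 < (2 : R) ^+ (4 + m) by exact: exprn_gt0.
have W0 : 0 < W by rewrite mulr_gt0// mulr_gt0.
have eW : 0 < e / W by rewrite divr_gt0.
have [eta eta0 H] := discounted_generator eW.
have mn0 : 0 < Num.min eta a by rewrite lt_min eta0.
(* The mesh [T / (N + 1)] lies below [eta] for the generator bound and below [a] for the
   telescoping. *)
pose N := Num.truncn (T / Num.min eta a); pose t := T / N.+1%:R.
have t0 : 0 < t by rewrite divr_gt0.
have tmin : t < Num.min eta a.
  by rewrite /t ltr_pdivrMr// mulrC -ltr_pdivrMr// truncnS_gt.
have [te ta] : t < eta /\ t < a by move: tmin; rewrite lt_min => /andP.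
have NtT : N.+1%:R * t = T by rewrite /t mulrC divfK// pnatr_eq0.
have := discounted_telescope x h0 t0 (ltW ta) _ (H _ t0 te) (N := N.+1).
rewrite NtT lexx => /(_ isT); rewrite -/a -/D.
set z := iter (4 + m) (fdiff h) f x.
rewrite iter_Q// iter_fdiffZ iter_S// NtT.
set y := iter (4 + m) (fdiff h) (S T f) x.
have y1 : `|expR (rho * T) * y| <= E * (kappa ^+ (4 + m) * (a * D) * Bf).
  rewrite normrM gtr0_norm ?expR_gt0//; apply: ler_pM => //; first exact: expR_le_E (ltW T_gt0) _.
  have := iter_fdiff_S_le h (3 + m) T_gt0 (lexx T) bf fB x; rewrite -/y.
  move=> /le_trans; apply; rewrite ler_wpM2r//.
  rewrite (_ : K * enorm h * _ = kappa * enorm h); last by rewrite /kappa; ring.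
  rewrite exprMn ler_wpM2l ?exprn_ge0//.
  rewrite /a /D -powRD ?(gt_eqF eh0) ?implybT//.
  apply: powR_ge_expn; first by rewrite eh0.
  by rewrite -[(3 + m).+1]/(4 + m)%N natrD; move: alpha_le2 delta_lt; lra.
move=> tel.
have z1 : `|z| <= `|expR (rho * T) * y| + `|expR (rho * T) * y - z|.
  have := ler_normB (expR (rho * T) * y) (expR (rho * T) * y - z).
  by rewrite opprB addrC subrK.
have tel2 : 2 * E * C0 * G * D * (a - a ^+ 2 / (a + T)) + T * (2 ^+ (4 + m) * E * (e / W)) <=
   2 * E * C0 * G * D * a + e.
  rewrite lerD//; last by rewrite le_eqVlt; apply/orP; left; apply/eqP; rewrite /W; field;
    rewrite !gt_eqF// exprn_gt0.
  apply: ler_wpM2l; first by rewrite !mulr_ge0// ltW.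
  rewrite lerBlDr lerDl.
  by rewrite divr_ge0// ?sqr_ge0// ltW// addr_gt0.
apply: (le_trans z1); apply: (le_trans (lerD y1 (le_trans tel tel2))).
rewrite addrA lerD2r.
have -> : (E * kappa ^+ (4 + m) + 2 * E * C0) * (G + Bf) * (a * D) =
  E * (kappa ^+ (4 + m) * (a * D) * Bf) + 2 * E * C0 * G * D * a +
  (E * kappa ^+ (4 + m) * G + 2 * E * C0 * Bf) * (a * D) by ring.
rewrite lerDl; apply: mulr_ge0; last by rewrite mulr_ge0// ltW.
apply: addr_ge0; last by rewrite !mulr_ge0// ltW.
have kp0 : 0 <= kappa ^+ (4 + m) by exact: exprn_ge0.
by rewrite mulr_ge0// mulr_ge0// ltW.
Qed.

End regularizing_semigroup.

(** * Differentiability on the line from second differences *)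

Section zygmund_line.
Context (R : realType).
Implicit Types (s t x : R).

(** Cauchy's equation: [L s - s * L 1] is additive and vanishes at natural numbers, so it is bounded
    on the half-line by its values on [0, 1[; being homogeneous under integer multiples, it must be
    0. *)
Lemma additive_bounded_linear (L : R -> R) (B : R) :
  (forall s t, L (s + t) = L s + L t) -> (forall s, `|s| <= 1 -> `|L s| <= B) ->
  forall s, L s = s * L 1.
Proof.
move=> Ladd LB; pose G s := L s - s * L 1.
have Gadd s t : G (s + t) = G s + G t by rewrite /G Ladd; ring.
have G1 : G 1 = 0 by rewrite /G mul1r subrr.
have G0 : G 0 = 0 by have := Gadd 0 0; rewrite addr0; lra.
have GM (k : nat) s : G (k%:R * s) = k%:R * G s.
  elim: k => [|k IH]; first by rewrite !mul0r.
  by rewrite -[k.+1%:R]natr1 !mulrDl !mul1r Gadd IH.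
have B0 : 0 <= B.
  by apply: le_trans (LB 0 _); rewrite ?normr0.
have GB s : 0 <= s -> `|G s| <= 2 * B.
  move=> s0.
  have -> : G s = G (s - (Num.truncn s)%:R).
    have GT : G (Num.truncn s)%:R = 0 by rewrite -[X in G X]mulr1 GM G1 mulr0.
    by have := Gadd (s - (Num.truncn s)%:R) (Num.truncn s)%:R; rewrite subrK GT addr0.
  set r := s - _.
  have /andP[r0 r1] : 0 <= r < 1.
    have /andP[h1 h2] := truncn_itv s0.
    by rewrite /r subr_ge0 h1 ltrBlDl natr1.
  have rn : `|r| <= 1 by rewrite ger0_norm// ltW.
  rewrite /G (le_trans (ler_normB _ _))// normrM mulr2n mulrDl mul1r.
  apply: lerD; first exact: LB.
  rewrite -[leRHS]mul1r; apply: ler_pM => //.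
  by apply: LB; rewrite normr1.
have Gz s : 0 <= s -> G s = 0.
  move=> s0; apply/eqP; rewrite -normr_le0; apply/ler_addgt0Pr => e e0.
  pose k := (Num.truncn (2 * B / e)).+1.
  have k0 : 0 < k%:R :> R by rewrite ltr0n.
  have := GB _ (mulr_ge0 (ltW k0) s0).
  rewrite GM normrM (gtr0_norm k0) add0r -ler_pdivlMl// => /le_trans; apply.
  rewrite ler_pdivrMl// -ler_pdivrMr//.
  by apply: ltW; exact: truncnS_gt.
move=> s; apply/eqP; rewrite -subr_eq0 -/(G s); apply/eqP.
have [s0|s0] := leP 0 s; first exact: Gz.
have := Gadd s (- s); rewrite subrr G0 (Gz (- s)) ?addr0; first by [].
by rewrite oppr_ge0 ltW.
Qed.

(* A second difference of order [beta > 1] makes the dyadic difference quotients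
   converge; their limit is additive in the step because the mixed second
   difference with steps [s], [t] is a difference of two symmetric ones. *)
Lemma zygmund_derivative (beta C : R) : 1 < beta -> 0 <= C ->
  exists C', forall (phi : R -> R) (B : R), (forall x, `|phi x| <= B) ->
   (forall x s, `|phi (x + s + s) - 2 * phi (x + s) + phi x| <= C * `|s| `^ beta) ->
   forall x, exists D, forall s, `|phi (x + s) - phi x - s * D| <= C' * `|s| `^ beta.
Proof.
move=> b1 C0; have b0 : 0 < beta by exact: lt_trans b1.
pose q : R := 2 / 2 `^ beta.
have p2 : 0 < (2 : R) `^ beta by exact: powR_gt0.
have q0 : 0 < q by rewrite divr_gt0.
have q1 : q < 1.
  rewrite ltr_pdivrMr// mul1r -{1}[2]powRr1// /powR pnatr_eq0 /= ltr_expR.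
  by rewrite ltr_pM2r// ln_gt0// ltr1n.
pose C' := C / 2 `^ beta / (1 - q); exists C' => phi B phiB phiC x.
have B0 : 0 <= B by exact: le_trans (phiB 0).
have C'0 : 0 <= C' by rewrite divr_ge0 ?subr_ge0 ?(ltW q1)// divr_ge0// ltW.
(* Difference quotients multiplied by [s], so that the limit stands for [s] times the derivative and
   makes sense at [s = 0]. *)
pose a s (k : nat) := 2 ^+ k * (phi (x + s / 2 ^+ k) - phi x).
have e2 (k : nat) : 0 < (2 : R) ^+ k by exact: exprn_gt0.
have powS s (k : nat) : `|s / 2 ^+ k| `^ beta * 2 ^+ k = `|s| `^ beta * q ^+ k.
  rewrite normrM powRM// normfV (gtr0_norm (e2 k)) /q expr_div_n.
  have -> : (2 ^+ k)^-1 `^ beta = ((2 : R) `^ beta ^+ k)^-1 :> R.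
    rewrite -powR_inv1 ?ltW// -powRrM mulN1r powRN; congr (_^-1).
    by rewrite -(powR_mulrn k (ler0n _ 2)) -powRrM mulrC powRrM powR_mulrn ?powR_ge0.
  by ring.
have astep s (k : nat) : `|a s k.+1 - a s k| <= geometric (C / 2 `^ beta * `|s| `^ beta) q k.
  have -> : a s k.+1 - a s k = - (2 ^+ k * (phi (x + s / 2 ^+ k.+1 + s / 2 ^+ k.+1) -
       2 * phi (x + s / 2 ^+ k.+1) + phi x)).
    have -> : x + s / 2 ^+ k.+1 + s / 2 ^+ k.+1 = x + s / 2 ^+ k.
      by rewrite exprS; field; rewrite gt_eqF.
    by rewrite /a exprS; ring.
  rewrite normrN normrM (gtr0_norm (e2 k)).
  apply: (le_trans (ler_wpM2l (ltW (e2 k)) (phiC x (s / 2 ^+ k.+1)))).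
  have -> : 2 ^+ k * (C * `|s / 2 ^+ k.+1| `^ beta) =
      C / 2 * (`|s / 2 ^+ k.+1| `^ beta * 2 ^+ k.+1) by rewrite exprS; field.
  rewrite powS /geometric /= exprS /q le_eqVlt; apply/orP; left; apply/eqP.
  by field; rewrite gt_eqF.
have geo s : 0 <= C / 2 `^ beta * `|s| `^ beta.
  by rewrite mulr_ge0 ?powR_ge0// divr_ge0// ltW.
have acvg s : cvgn (a s).
  have -> : a s = fun k => a s 0 + series (telescope (a s)) k.
    by apply/funext => k; rewrite -eq_sum_telescope.
  apply: is_cvgD; first exact: is_cvg_cst.
  apply: normed_cvg; apply: (@series_le_cvg _ _ (geometric (C / 2 `^ beta * `|s| `^ beta) q)).
  - by move=> k; exact: normr_ge0.
  - by move=> k; rewrite /geometric /= mulr_ge0// exprn_ge0// ltW.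
  - by move=> k; exact: astep.
  - by apply: is_cvg_geometric_series; rewrite gtr0_norm.
pose L s := limn (a s).
have aL s : a s k @[k --> \oo] --> L s by exact: acvg.
have abound s k : `|a s k - a s 0| <= C' * `|s| `^ beta.
  have -> : a s k - a s 0 = series (telescope (a s)) k.
    by rewrite [a s k]eq_sum_telescope addrC addKr.
  apply: (le_trans (ler_norm_sum _ _ _)).
  apply: (@le_trans _ _ (series (geometric (C / 2 `^ beta * `|s| `^ beta) q) k)).
    by apply: ler_sum => i _; exact: astep.
  rewrite geometric_seriesE ?lt_eqF//.
  have -> : C' * `|s| `^ beta = C / 2 `^ beta * `|s| `^ beta * (1 / (1 - q)).
    by rewrite /C'; ring.
  rewrite -[leLHS]mulrA; apply: ler_wpM2l => //.
  rewrite ler_pM2r ?invr_gt0 ?subr_gt0//.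
  by rewrite lerBlDr lerDl exprn_ge0// ltW.
have Lbound s : `|phi (x + s) - phi x - L s| <= C' * `|s| `^ beta.
  have a0 : a s 0 = phi (x + s) - phi x by rewrite /a expr0 divr1 mul1r.
  rewrite -a0 distrC.
  have lim1 : `|a s k - a s 0| @[k --> \oo] --> `|L s - a s 0|.
    by apply: cvg_norm; apply: cvgB => //; exact: cvg_cst.
  by apply: (cvgr_to_le lim1); near=> k; exact: abound.
have Ladd s t : L (s + t) = L s + L t.
  apply/eqP; rewrite -subr_eq0 opprD addrA; apply/eqP.
  have lim1 : a (s + t) k - a s k - a t k @[k --> \oo] --> L (s + t) - L s - L t.
    by apply: cvgB => //; exact: cvgB.
  have lim2 : a (s + t) k - a s k - a t k @[k --> \oo] --> (0 : R).
    pose M := C * (`|(s + t) / 2| `^ beta + `|(t - s) / 2| `^ beta).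
    have qlim : M * q ^+ k @[k --> \oo] --> (0 : R).
      rewrite -[X in _ --> X](mulr0 M); apply: cvgM; first exact: cvg_cst.
      by apply: cvg_expr; rewrite gtr0_norm.
    apply/norm_cvg0P; apply: (squeeze_cvgr _ (cvg_cst 0) qlim).
    near=> k; rewrite normr_ge0 /=.
    pose S := s / 2 ^+ k; pose T := t / 2 ^+ k.
    (* Both second differences have the midpoint [x + (S + T) / 2], whose values cancel and leave
       the mixed difference. *)
    have -> : a (s + t) k - a s k - a t k = 2 ^+ k *
       ((phi (x + (S + T) / 2 + (S + T) / 2) - 2 * phi (x + (S + T) / 2) + phi x) -
        (phi (x + S + (T - S) / 2 + (T - S) / 2) - 2 * phi (x + S + (T - S) / 2) + phi (x + S))).
      have -> : x + (S + T) / 2 + (S + T) / 2 = x + (s + t) / 2 ^+ k.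
        by rewrite /S /T; field; rewrite gt_eqF.
      have -> : x + S + (T - S) / 2 + (T - S) / 2 = x + t / 2 ^+ k.
        by rewrite /S /T; field; rewrite gt_eqF.
      have -> : x + S + (T - S) / 2 = x + (S + T) / 2 by field.
      by rewrite /a /S; ring.
    rewrite normrM (gtr0_norm (e2 k)).
    have h1 := phiC x ((S + T) / 2); have h2 := phiC (x + S) ((T - S) / 2).
    apply: (le_trans (ler_wpM2l (ltW (e2 k)) (le_trans (ler_normB _ _) (lerD h1 h2)))).
    have -> : (S + T) / 2 = (s + t) / 2 / 2 ^+ k by rewrite /S /T; field; rewrite gt_eqF.
    have -> : (T - S) / 2 = (t - s) / 2 / 2 ^+ k by rewrite /S /T; field; rewrite gt_eqF.
    rewrite mulrC mulrDl -[C * _ * _]mulrA powS -[C * _ * _ in leLHS]mulrA powS /M.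
    by rewrite le_eqVlt; apply/orP; left; apply/eqP; ring.
  exact: (cvg_unique _ lim1 lim2).
exists (L 1) => s.
have LB r : `|r| <= 1 -> `|L r| <= 2 * B + C'.
  move=> r1; have h1 := Lbound r.
  have h2 : `|phi (x + r) - phi x| <= 2 * B.
    by rewrite (le_trans (ler_normB _ _))// mulr2n mulrDl mul1r lerD.
  have h3 : `|r| `^ beta <= 1.
    have [->|r0] := eqVneq r 0; first by rewrite normr0 powR0 ?gt_eqF.
    rewrite -(powRr0 `|r|); apply: ger_powR; last exact: ltW.
    by rewrite normr_gt0 r0.
  have h4 : C' * `|r| `^ beta <= C' by rewrite ler_piMr.
  have := ler_normB (phi (x + r) - phi x) (phi (x + r) - phi x - L r).
  by rewrite opprB addrC subrK; lra.
by rewrite -(additive_bounded_linear Ladd LB).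
Unshelve. all: by end_near.
Qed.

End zygmund_line.

(** * First derivatives vanishing at infinity *)

Section C1_infty.
Context (R : realType) (n : nat).
Implicit Types (f : 'rV[R]_n -> R) (h x v : 'rV[R]_n).

Lemma cvg_at_infty_shift f v (l : R) : f x @[x --> at_infty R n] --> l ->
  f (x + v) @[x --> at_infty R n] --> l.
Proof.
move=> fl A /fl [r rA].
pose r' := Num.max r 0.
(* The radius comes from [|x|^2 <= 2 |x + v|^2 + 2 |v|^2]; [r'] is used because [r] may be
   negative. *)
exists (Num.sqrt (2 * r' ^+ 2 + 2 * enorm v ^+ 2)) => x xr; apply: rA.
have r'0 : 0 <= r' by rewrite le_max lexx orbT.
apply: (@le_lt_trans _ _ r'); first by rewrite le_max lexx.
have enorm2 y : enorm y ^+ 2 = dot y y by rewrite sqr_sqrtr// dot_ge0.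
have dotle : dot x x <= 2 * dot (x + v) (x + v) + 2 * dot v v.
  rewrite /dot !mulr_sumr -big_split /=; apply: ler_sum => i _; rewrite !mxE.
  have := sqr_ge0 (x ord0 i + 2 * v ord0 i); nra.
have {}xr : 2 * r' ^+ 2 + 2 * enorm v ^+ 2 < enorm x ^+ 2.
  have ex0 := le_lt_trans (sqrtr_ge0 _) xr.
  by rewrite -ltr_sqrt ?exprn_gt0// sqrtr_sqr gtr0_norm.
rewrite ltNge; apply/negP => hle.
have : enorm (x + v) ^+ 2 <= r' ^+ 2 by rewrite lerXn2r// nnegrE ?enorm_ge0.
rewrite !enorm2 in xr *; lra.
Qed.

Lemma C_infty_quotient f v (a : R) : C_infty f -> C_infty (fun x => a * (f (x + v) - f x)).
Proof.
move=> [cf f0]; split.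
  move=> x; apply: (@cvgM _ _ (nbhs x)); first exact: cvg_cst.
  apply: (@cvgB _ _ _ (nbhs x)); last exact: cf.
  apply: (@continuous_comp _ _ _ (fun x => x + v) f); last exact: cf.
  by apply: (@cvgD _ _ _ (nbhs x)); [exact: cvg_id|exact: cvg_cst].
rewrite -[X in _ --> X](mulr0 a) -[X in a * X](subr0 0).
apply: cvgM; first exact: cvg_cst.
by apply: cvgB => //; exact: cvg_at_infty_shift.
Qed.

Lemma C_infty_uniform_limit f : (forall e : R, 0 < e -> exists2 g, C_infty g &
  forall x, `|f x - g x| <= e) -> C_infty f.
Proof.
move=> H; split.
- move=> x; apply/(@cvgrPdist_le _ _ _ (nbhs x) _) => e e0.
  have e3 : 0 < e / 3 by rewrite divr_gt0.
  have [g [cg _] gf] := H _ e3.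
  move/(@cvgrPdist_le _ _ _ (nbhs x) _) : (cg x) => /(_ _ e3); apply: filterS => y gy.
  have -> : f x - f y = (f x - g x) + (g x - g y) - (f y - g y) by ring.
  apply: (le_trans (ler_normB _ _)); apply: (le_trans (lerD (ler_normD _ _) (lexx _))).
  have := gf x; have := gf y; have -> : e = e / 3 + e / 3 + e / 3 by field.
  by move=> h1 h2; rewrite lerD// lerD.
- apply/cvgrPdist_le => e e0.
  have e2 : 0 < e / 2 by rewrite divr_gt0.
  have [g [_ g0] gf] := H _ e2.
  have /cvgrPdist_le/(_ _ e2) := g0; apply: filterS => y.
  rewrite !sub0r !normrN => gy.
  have := ler_normD (f y - g y) (g y); rewrite subrK => /le_trans; apply.
  have -> : e = e / 2 + e / 2 by field.
  by rewrite lerD.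
Qed.

(** The constant of [zygmund_derivative] is fixed before the function of one variable, hence is the
    same on every line parallel to an axis; the quotients therefore converge uniformly in [x], at
    rate [|s|^(beta - 1)]. *)
Lemma Ck_infty1_of_second_difference f (B C beta : R) : C_infty f ->
  (forall x, `|f x| <= B) -> 1 < beta -> 0 <= C ->
  (forall h x, h != 0 -> `|iter 2 (fdiff h) f x| <= C * enorm h `^ beta) ->
  Ck_infty 1 f.
Proof.
move=> Cf fB b1 C0 fC.
have b0 : 0 < beta by exact: lt_trans b1.
split => // i; set e := delta_mx ord0 i.
have ee : enorm e = 1.
  rewrite /enorm /dot (bigD1 i)//= big1 ?addr0; last first.
    by move=> j ji; rewrite /e !mxE eqxx (negbTE ji) mul0r.
  by rewrite /e !mxE !eqxx mul1r sqrtr1.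
have [C' HC'] := zygmund_derivative b1 C0.
have DE x : exists D, forall s, `|f (x + s *: e) - f x - s * D| <= C' * `|s| `^ beta.
  have [] := HC' (fun r : R => f (x + r *: e)) B _ _ 0.
  - by move=> r; exact: fB.
  - move=> r s; have [->|s0] := eqVneq s 0.
      rewrite !addr0 normr0 powR0 ?gt_eqF// mulr0.
      by rewrite (_ : _ + _ = 0) ?normr0//; ring.
    have se0 : s *: e != 0.
      apply: contra s0 => /eqP se; have := enormZ s e.
      have e0 : enorm (0 : 'rV[R]_n) = 0.
        by rewrite -(scale0r (0 : 'rV[R]_n)) enormZ normr0 mul0r.
      by rewrite se ee mulr1 e0 => /esym/eqP; rewrite normr_eq0.
    have := fC (s *: e) (x + r *: e) se0.
    rewrite enormZ ee mulr1 /= /fdiff.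
    rewrite -!addrA -!scalerDl.
    apply: le_trans; rewrite le_eqVlt; apply/orP; left; apply/eqP.
    by congr (`|_|); ring.
  - move=> D HD; exists D => s; have := HD s.
    by rewrite add0r scale0r addr0.
pose D x := sval (cid (DE x)).
have DP x s : `|f (x + s *: e) - f x - s * D x| <= C' * `|s| `^ beta.
  by rewrite /D; case: cid.
(* The sign is recovered from the estimate itself at [s = 1]. *)
have C'0 : 0 <= C' by have := le_trans (normr_ge0 _) (DP 0 1); rewrite normr1 powR1 mulr1.
have b1' : 0 < beta - 1 by rewrite subr_gt0.
have DQ x (s : R) : s != 0 -> `|s^-1 * (f (x + s *: e) - f x) - D x| <= C' * `|s| `^ (beta - 1).
  move=> s0; have ns0 : 0 < `|s| by rewrite normr_gt0.
  rewrite -(ler_pM2l ns0) -normrM mulrBr mulVKf//.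
  apply: (le_trans (DP x s)); rewrite mulrCA mulr_powRB1//.
have small (eps : R) : 0 < eps -> exists2 del : R, 0 < del &
    forall s : R, s != 0 -> `|s| <= del -> C' * `|s| `^ (beta - 1) <= eps.
  move=> eps0; have C1 : 0 < C' + 1 by rewrite ltr_wpDl.
  have ec : 0 < eps / (C' + 1) by rewrite divr_gt0.
  exists ((eps / (C' + 1)) `^ (beta - 1)^-1); first exact: powR_gt0.
  move=> s s0 sd; have ns0 : 0 < `|s| by rewrite normr_gt0.
  have h : `|s| `^ (beta - 1) <= eps / (C' + 1).
    have := ge0_ler_powR (ltW b1'); move=> /(_ `|s| ((eps / (C' + 1)) `^ (beta - 1)^-1)).
    rewrite !nnegrE normr_ge0 powR_ge0 => /(_ isT isT sd).
    by rewrite -powRrM mulVf ?gt_eqF// powRr1// ltW.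
  have := ler_wpM2l C'0 h; move=> /le_trans; apply.
  rewrite mulrA ler_pdivrMr// mulrC ler_pM2l//; lra.
have lim x : h^-1 *: ((f \o shift x) (h *: e) - f x) @[h --> 0^'] --> D x.
  apply/cvgrPdist_le => eps eps0; have [del del0 Hd] := small _ eps0.
  near=> s.
  have s0 : s != 0 by near: s; exact: nbhs_dnbhs_neq.
  have sd : `|s| <= del.
    near: s; apply: dnbhs0_le; exact: del0.
  rewrite distrC; apply: le_trans (Hd s s0 sd).
  by rewrite /= (addrC (s *: e)); exact: DQ.
have dE : partial i f = D.
  by apply/funext => x; rewrite /partial /derive; apply: cvg_lim => //; exact: lim.
split; first by move=> x; apply/cvg_ex; exists (D x); exact: lim.
rewrite dE; split => //.
apply: C_infty_uniform_limit => eps eps0; have [del del0 Hd] := small _ eps0.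
exists (fun x => del^-1 * (f (x + del *: e) - f x)); first exact: C_infty_quotient.
move=> x; rewrite distrC; have dn0 : del != 0 by rewrite gt_eqF.
apply: (le_trans (DQ x del dn0)); apply: Hd => //.
by rewrite gtr0_norm.
Unshelve. all: by end_near.
Qed.

End C1_infty.

(** * Sup norms and Hölder seminorms as real constants *)

Section function_spaces_theory.
Context (R : realType) (n : nat).
Implicit Types (f : 'rV[R]_n -> R) (h x : 'rV[R]_n).

Lemma le_supnorm f x : (`|f x|%:E <= supnorm f)%E.
Proof. by apply: ereal_sup_ubound; exists x. Qed.

Lemma supnorm_le f (c : R) : (forall x, `|f x| <= c) -> (supnorm f <= c%:E)%E.
Proof. by move=> fc; apply: ge_ereal_sup => _ [x _ <-]; rewrite lee_fin. Qed.

Lemma supnorm_fine f : C_b f ->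
  exists2 B : R, supnorm f = B%:E & forall x, `|f x| <= B.
Proof.
move=> [_ foo].
have ffin : supnorm f \is a fin_num.
  rewrite ge0_fin_numE//; apply: le_trans (le_supnorm f 0).
  by rewrite lee_fin.
exists (fine (supnorm f)); first by rewrite fineK.
by move=> x; rewrite -lee_fin fineK//; exact: le_supnorm.
Qed.

Lemma bmeas_C_b f : C_b f -> bmeas f.
Proof.
move=> Cf; have [B _ fB] := supnorm_fine Cf; split; last by exists B.
by apply: continuous_measurable_rV; case: Cf.
Qed.

Lemma C_infty_C_b f : C_infty f -> C_b f.
Proof.
move=> [cf f0]; split => //.
have [r Hr] : at_infty R n [set x | `|f x| < 1].
  move/cvgrPdist_lt : f0 => /(_ _ ltr01); apply: filterS => x.
  by rewrite sub0r normrN.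
(* A compact cube containing the Euclidean ball of radius [r]; [|r|] keeps it nonempty when
   [r < 0]. *)
pose K : set 'rV[R]_n := [set v | forall i, `[(- `|r|), `|r|]%classic (v ord0 i)].
have cK : compact K.
  have cI : compact `[(- `|r|), `|r|]%classic by exact: segment_compact.
  have := @rV_compact _ n _ (fun=> cI).
  exact.
have K0 : K !=set0.
  by exists 0 => i /=; rewrite mxE in_itv/= oppr_le0 normr_ge0.
have cabs : continuous (fun x => `|f x|).
  by move=> x; apply: (@cvg_norm _ _ _ (nbhs x)); exact: cf.
have [c cinK cmax] := EVT_max_rV K0 cK (continuous_subspaceT cabs).
apply: (@le_lt_trans _ _ (1 + `|f c|)%:E); last exact: ltry.
apply: supnorm_le => x.
have [xr|xr] := ltP r (enorm x).
  by apply: (le_trans (ltW (Hr x xr))); rewrite lerDl.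
have : x \in K.
  rewrite inE => i /=; rewrite in_itv/= -ler_norml.
  apply: (le_trans (ler_coord_enorm x i)); apply: (le_trans xr); exact: ler_norm.
by move=> /cmax /le_trans; apply; rewrite lerDr.
Qed.

Lemma holder_seminorm_ge (gamma : R) f h x : h != 0 ->
  ((`|iter (Num.truncn gamma).+1 (fdiff h) f x| / enorm h `^ gamma)%:E <=
    holder_seminorm gamma f)%E.
Proof. by move=> h0; apply: ereal_sup_ubound; exists (x, h). Qed.

Lemma holder_seminorm_le (gamma C : R) f :
  (forall h x, h != 0 ->
    `|iter (Num.truncn gamma).+1 (fdiff h) f x| <= C * enorm h `^ gamma) ->
  (holder_seminorm gamma f <= C%:E)%E.
Proof.
move=> fC; apply: ge_ereal_sup => _ [[x h] /= h0 <-]; rewrite lee_fin.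
by rewrite ler_pdivrMr ?powR_gt0 ?enorm_gt0//; exact: fC.
Qed.

(** A positive dimension supplies a nonzero step; without one the supremum would be over the empty
    set and equal to [-oo]. *)
Lemma holder_seminorm_fine (gamma : R) f : (0 < n)%N -> Cb_gamma gamma f ->
  exists2 G : R, holder_seminorm gamma f = G%:E /\ 0 <= G &
    forall h x, h != 0 ->
      `|iter (Num.truncn gamma).+1 (fdiff h) f x| <= G * enorm h `^ gamma.
Proof.
move=> n0 [Cf foo].
have h10 : (const_mx 1 : 'rV[R]_n) != 0.
  apply/eqP => /rowP /(_ (Ordinal n0)); rewrite !mxE; apply/eqP.
  exact: oner_neq0.
have G0 : (0 <= holder_seminorm gamma f)%E.
  apply: le_trans (holder_seminorm_ge gamma f 0 h10).
  by rewrite lee_fin divr_ge0// powR_ge0.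
have Gfin : holder_seminorm gamma f \is a fin_num.
  rewrite ge0_fin_numE//; apply: le_lt_trans foo.
  rewrite /holder_norm leeDr//; apply: le_trans (le_supnorm f 0).
  by rewrite lee_fin.
exists (fine (holder_seminorm gamma f)); first by rewrite fineK// fine_ge0.
move=> h x h0; rewrite -ler_pdivrMr ?powR_gt0 ?enorm_gt0//.
by rewrite -lee_fin fineK//; exact: holder_seminorm_ge.
Qed.

Lemma C_b_Cb_gamma0 f : C_b f -> Cb_gamma 0 f.
Proof.
move=> Cf; split => //; have [B fE fB] := supnorm_fine Cf.
rewrite /holder_norm fE.
apply: (@le_lt_trans _ _ (B%:E + (2 * B)%:E)%E); last by rewrite -EFinD ltry.
rewrite leeD2l//; apply: holder_seminorm_le => h x h0.
by rewrite powRr0 mulr1 truncn0 -[2 * B](_ : 2 ^+ 1 * B = _) ?expr1//; exact: iter_fdiff_bound.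
Qed.

End function_spaces_theory.

(** * The Schauder estimate and the domain of the generator *)

Section levy_schauder.
Context (R : realType) (d : nat) (M T alpha : R).
Hypothesis d_gt0 : (0 < d)%N.
Hypothesis M_gt0 : 0 < M.
Hypothesis T_gt0 : 0 < T.
Hypothesis alpha_gt0 : 0 < alpha.
Hypothesis alpha_le2 : alpha <= 2.

Section one_process.
Context (disp : measure_display) (Omega : measurableType disp)
  (P : probability Omega R) (X : R -> {RV P >-> 'rV[R]_d})
  (p : R -> 'rV[R]_d -> R).
Hypothesis levyX : is_levy X.
Hypothesis densityX : is_transition_density X p.
Hypothesis gradp : gradient_bound p M T alpha.

(** The 2 comes from shifting a bounded function to a nonnegative one, [d] from moving along the
    coordinates one by one. *)
Let K : R := 2 * d%:R * M.

Let K_ge0 : 0 <= K. Proof. by rewrite mulr_ge0 ?mulr_ge0 ?ler0n// ltW. Qed.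

Lemma density_partial_L1 (t : R) i : 0 < t -> t <= T ->
  (\int[lebesgue_rV R d]_x `|partial i (p t) x|%:E <= (M * t `^ (- alpha^-1))%:E)%E.
Proof.
move=> t0 tT; apply: le_trans (gradp t0 tT).
have [pb _ _] := densityX t0.
have mpart j : measurable_fun setT (partial j (p t)).
  apply: continuous_measurable_rV.
  by have [_ /(_ j) [_ [[]]]] := pb 1%N.
apply: ge0_le_integral => //.
- by apply/measurable_EFinP; apply: measurableT_comp => //; exact: mpart.
- apply/measurable_EFinP.
  apply: (@measurableT_comp _ _ _ _ _ _ (@Num.sqrt R)).
    by apply: continuous_measurable_fun; exact: sqrt_continuous.
  apply: measurable_sum => j.
  by under eq_fun do rewrite !mxE; apply: measurable_funM; exact: mpart.
- move=> x _; rewrite lee_fin.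
  by apply: le_trans (ler_coord_enorm _ i); rewrite mxE.
Qed.

Lemma semigroup_smoothing (t : R) h u (c : R) : 0 < t -> t <= T -> bmeas u ->
  (forall x, `|u x| <= c) ->
  forall x, `|fdiff h (semigroup X t u) x| <= K * enorm h * t `^ (- alpha^-1) * c.
Proof.
move=> t0 tT bu uc x.
have c0 : 0 <= c by exact: le_trans (uc 0).
have [pb p0 pE] := densityX t0.
have cp : continuous (p t) by have [[]] := pb 0%N.
rewrite /fdiff semigroupE//.
have -> : K * enorm h * t `^ (- alpha^-1) * c =
  d%:R * enorm h * (2 * c * (M * t `^ (- alpha^-1))) by rewrite /K; ring.
apply: lipschitz_of_coordinates.
  by rewrite !mulr_ge0// ?powR_ge0// ltW.
move=> i y s.
have [_ /(_ i) [dp [[cdp _] _]]] := pb 1%N.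
apply: (convm_lipschitz_dir p0 cp _ bu uc dp cdp).
- by move=> A mA; exact: pE.
- exact: density_partial_L1.
Qed.

Lemma is_generator_le f Af : is_generator X f Af -> forall e : R, 0 < e ->
  exists2 eta : R, 0 < eta & forall t : R, 0 < t -> t < eta ->
    forall x, `|semigroup X t f x - f x - t * Af x| <= e * t.
Proof.
move=> [_ _ lim0] e e0.
have e0' : (0 : R) < (fun=> e) (0 : R) by [].
have := lim0 _ (nbhs_open_ereal_lt e0').
move=> /nbhs_ballP [eta /= eta0 He].
exists eta => // t t0 teta x.
have := He t; rewrite /ball /= sub0r normrN gtr0_norm// => /(_ teta t0) /= lt_e.
have := le_lt_trans (le_supnorm _ x) lt_e; rewrite lte_fin => /ltW.
have -> : semigroup X t f x - f x - t * Af x =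
   t * (t^-1 * (semigroup X t f x - f x) - Af x).
  by rewrite mulrBr mulrA divff ?mul1r// gt_eqF.
by rewrite normrM gtr0_norm// [e * t]mulrC ler_pM2l.
Qed.

Lemma generator_fdiff_estimate (rho delta : R) f Af g (Bf G : R) (m : nat) :
  0 <= delta -> delta < m%:R ->
  is_generator X f Af -> (forall x, Af x + rho * f x = g x) ->
  (forall x, `|f x| <= Bf) -> 0 <= G ->
  (forall h x, h != 0 -> `|iter m (fdiff h) g x| <= G * enorm h `^ delta) ->
  forall h x, h != 0 -> enorm h <= 1 ->
  `|iter (4 + m) (fdiff h) f x| <=
    (expR (`|rho| * T) * (K * (T / (4 + m)%:R) `^ (- alpha^-1)) ^+ (4 + m) +
      2 * expR (`|rho| * T) * (400 + 25 * K ^+ 4)) *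
    (G + Bf) * enorm h `^ (alpha + delta).
Proof.
move=> d0 dm genf gE fB G0 gG h x h0 h1.
have [Cf CAf _] := genf.
have bf := bmeas_C_b (C_infty_C_b Cf).
have bAf := bmeas_C_b (C_infty_C_b CAf).
have [_ [A0 AfB]] := bAf.
apply: (@fdiff_estimate _ _ alpha T K (semigroup X) _ _ _ _ _ _ _ _ _ _ _
  f Af g rho delta Bf A0 G m) => //.
- by move=> t u t0 bu; rewrite semigroupE//; exact: bmeas_convm.
- by move=> t u c t0 bu uc y; rewrite semigroupE//; exact: convm_bound.
- by move=> t u v t0 bu bv; rewrite !semigroupE ?convmB//; exact: bmeasB.
- by move=> t a u t0 bu; rewrite !semigroupE ?convmZ//; exact: bmeasZ.
- by move=> t k u t0 bu; rewrite !semigroupE ?convm_fdiff//; exact: bmeas_fdiff.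
- by move=> s t u s0 t0 bu; exact: semigroupD.
- by move=> t k u c t0 tT bu uc y; exact: semigroup_smoothing.
- exact: is_generator_le.
Qed.

End one_process.

(** This keeps the target order floor(alpha + delta) + 1 at most [4 + m], so that Marchaud's
    inequality is only asked to lower the order. *)
Lemma truncnD_le2 (delta : R) : 0 <= delta ->
  (Num.truncn (alpha + delta) <= Num.truncn delta + 2)%N.
Proof.
move=> d0; rewrite -ltnS -(ltr_nat R).
have ad0 : 0 <= alpha + delta by rewrite addr_ge0// ltW.
have /andP[h1 _] := truncn_itv ad0.
have := truncnS_gt delta; rewrite -addnS -[(Num.truncn delta).+1%:R]natr1 natrD.
by move: alpha_le2; lra.
Qed.

Lemma schauder (rho delta : R) : 0 <= delta -> exists2 L : R, 0 <= L &
  forall (disp : measure_display) (Omega : measurableType disp)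
    (P : probability Omega R) (X : R -> {RV P >-> 'rV[R]_d})
    (p : R -> 'rV[R]_d -> R),
  is_levy X -> is_transition_density X p -> gradient_bound p M T alpha ->
  forall f Af g : 'rV[R]_d -> R,
  is_generator X f Af -> (forall x, Af x + rho * f x = g x) -> Cb_gamma delta g ->
  Cb_gamma (alpha + delta) f /\
  (holder_norm (alpha + delta) f <= L%:E * (holder_norm delta g + supnorm f))%E.
Proof.
move=> d0; pose gamma := alpha + delta.
have g0 : 0 <= gamma by rewrite addr_ge0// ltW.
pose m := (Num.truncn delta).+1; pose j := (Num.truncn gamma).+1.
have jm : (j <= 4 + m)%N.
  rewrite /j /m addnS ltnS; apply: (leq_trans (truncnD_le2 d0)).
  by rewrite addnC leq_add2r.
have gj : gamma < j%:R by exact: truncnS_gt.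
have [Km Km0 HKm] := @marchaud R d gamma j (4 + m - j) g0 gj.
rewrite subnK// in HKm.
set C1 : R := (expR (`|rho| * T) *
    (2 * d%:R * M * (T / (4 + m)%:R) `^ (- alpha^-1)) ^+ (4 + m) +
      2 * expR (`|rho| * T) * (400 + 25 * (2 * d%:R * M) ^+ 4)).
have C10 : 0 <= C1.
  have K0 : 0 <= 2 * d%:R * M by rewrite !mulr_ge0// ltW.
  apply: addr_ge0; apply: mulr_ge0.
  - exact: expR_ge0.
  - by apply: exprn_ge0; apply: mulr_ge0 => //; exact: powR_ge0.
  - by apply: mulr_ge0 => //; exact: expR_ge0.
  - apply: addr_ge0; first exact: ler0n.
    by apply: mulr_ge0; [exact: ler0n|exact: exprn_ge0].
have p20 : 0 <= (2 : R) ^+ (4 + m) by exact: exprn_ge0.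
(* [C1] serves for [|h| <= 1]; the added power of 2 is the trivial bound for larger steps, where
   [|h|^gamma >= 1]. In the final constant the summand 1 accounts for sup|f|. *)
pose C2 := C1 + 2 ^+ (4 + m).
have C20 : 0 <= C2 by exact: addr_ge0.
exists (1 + Km * C2); first by rewrite addr_ge0// mulr_ge0.
move=> disp Omega P X p levyX densX gradp f Af g genf gE Cg.
have [Cf CAf _] := genf; have Cbf := C_infty_C_b Cf.
have [Bf fE fB] := supnorm_fine Cbf.
have [G [GE G0] gG] := holder_seminorm_fine d_gt0 Cg.
have Bf0 : 0 <= Bf by exact: le_trans (fB 0).
have dm : delta < m%:R by exact: truncnS_gt.
have GB0 : 0 <= G + Bf by exact: addr_ge0.
have big h x : h != 0 -> `|iter (4 + m) (fdiff h) f x| <=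
    C2 * (G + Bf) * enorm h `^ gamma.
  move=> h0; have e0 : 0 <= enorm h `^ gamma by exact: powR_ge0.
  have [h1|h1] := leP (enorm h) 1.
    apply: (le_trans (generator_fdiff_estimate levyX densX gradp d0 dm genf gE fB G0 gG x h0 h1)).
    by rewrite -/C1 ler_wpM2r// ler_wpM2r// lerDl.
  apply: (le_trans (iter_fdiff_bound (4 + m) h fB x)).
  have e1 : 1 <= enorm h `^ gamma.
    by rewrite -(powRr0 (enorm h)) ler_powR// ltW.
  apply: (@le_trans _ _ (C2 * (G + Bf))); last by rewrite ler_peMr// mulr_ge0.
  by apply: ler_pM => //; [rewrite lerDr|rewrite lerDr].
have semi : (holder_seminorm gamma f <= (Km * (C2 * (G + Bf)))%:E)%E.
  apply: holder_seminorm_le; apply: (HKm f Bf) => //.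
  exact: mulr_ge0.
have normle : (holder_norm gamma f <= (1 + Km * C2)%:E * (holder_norm delta g + supnorm f))%E.
  have [Bg gsE gB] := supnorm_fine (proj1 Cg).
  have Bg0 : 0 <= Bg by exact: le_trans (gB 0).
  rewrite /holder_norm fE gsE GE -!EFinD -EFinM.
  apply: (@le_trans _ _ (Bf%:E + (Km * (C2 * (G + Bf)))%:E)%E); first exact: leeD2l.
  rewrite -EFinD lee_fin.
  have h1 : 0 <= Km * C2 * Bg by rewrite mulr_ge0// mulr_ge0.
  nra.
split => //; split => //; apply: (le_lt_trans normle).
have [Bg gsE gB] := supnorm_fine (proj1 Cg).
by rewrite /holder_norm fE gsE GE -!EFinD -EFinM ltry.
Qed.

Lemma max_below_lt (gamma : R) : max_below gamma = 0%N \/ (max_below gamma)%:R < gamma.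
Proof.
rewrite /max_below.
apply: (big_ind (fun k : nat => k = 0%N \/ k%:R < gamma)); first by left.
- by move=> x y Hx Hy; rewrite /maxn; case: ifP.
- by move=> i ig; right.
Qed.

(** As [alpha <= 2], at most one derivative is demanded, and one only when [alpha > 1]. *)
Lemma domain_Ck_infty (f : 'rV[R]_d -> R) : C_infty f -> Cb_gamma alpha f ->
  Ck_infty (max_below alpha) f.
Proof.
move=> Cf Hf; case: (max_below_lt alpha) => [->//|].
set k := max_below alpha => ka.
have k1 : (k <= 1)%N by rewrite -ltnS -(ltr_nat R) (lt_le_trans ka).
case: k ka k1 => [//|[|//]] a1 _.
(* At [alpha = 2] the seminorm involves third differences, and Marchaud's inequality reaches second
   ones only for an exponent below 2. An exponent strictly between 1 and 2 meets this and still
   yields a derivative. *)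
pose beta := (1 + alpha) / 2.
have b1 : 1 < beta by rewrite /beta; lra.
have b2 : beta < 2%:R by rewrite /beta; move: alpha_le2; lra.
have ba : beta <= alpha by rewrite /beta; lra.
have [B _ fB] := supnorm_fine (C_infty_C_b Cf).
have B0 : 0 <= B by exact: le_trans (fB 0).
have [G [_ G0] fG] := holder_seminorm_fine d_gt0 Hf.
have t1 : (1 <= Num.truncn alpha)%N by rewrite truncn_ge_nat ?ltW.
pose k := ((Num.truncn alpha).+1 - 2)%N.
have kE : (k + 2 = (Num.truncn alpha).+1)%N by rewrite subnK.
have [Km Km0 HKm] := @marchaud R d beta 2 k (ltW (lt_trans ltr01 b1)) b2.
pose C := G + 2 ^+ (k + 2) * B.
have C0 : 0 <= C by rewrite addr_ge0// mulr_ge0// exprn_ge0.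
apply: (@Ck_infty1_of_second_difference _ _ f B (Km * C) beta) => //.
  exact: mulr_ge0.
apply: (HKm f B) => // h x h0.
have e0 : 0 <= enorm h `^ beta by exact: powR_ge0.
have [h1|h1] := leP (enorm h) 1.
  rewrite kE; apply: (le_trans (fG h x h0)).
  apply: ler_pM => //; first exact: powR_ge0.
    by rewrite lerDl mulr_ge0// exprn_ge0.
  by apply: ger_powR => //; rewrite enorm_gt0.
apply: (le_trans (iter_fdiff_bound (k + 2) h fB x)).
apply: (@le_trans _ _ C); first by rewrite lerDr.
rewrite ler_peMr// -(powRr0 (enorm h)) ler_powR//; first exact: ltW.
by rewrite (le_trans _ (ltW b1)).
Qed.

End levy_schauder.

Theorem theorem1p1 (R : realType) (d : nat) (M T alpha : R)
    (d_gt0 : (0 < d)%N) (M_gt0 : 0 < M) (T_gt0 : 0 < T)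
    (alpha_gt0 : 0 < alpha) (alpha_le2 : alpha <= 2) :
  (forall rho delta : R, 0 <= delta ->
    exists L : R,
      forall (disp : measure_display) (Omega : measurableType disp)
        (P : probability Omega R) (X : R -> {RV P >-> 'rV[R]_d})
        (psi : 'rV[R]_d -> R[i]) (p : R -> 'rV[R]_d -> R),
      is_levy X -> is_char_exponent X psi -> hartman_wintner psi ->
      is_transition_density X p -> gradient_bound p M T alpha ->
      forall f Af g : 'rV[R]_d -> R,
      is_generator X f Af ->
      (forall x, Af x + rho * f x = g x) ->
      Cb_gamma delta g ->
      Cb_gamma (alpha + delta) f /\
      (holder_norm (alpha + delta) f
         <= L%:E * (holder_norm delta g + supnorm f))%E) /\
  (forall (disp : measure_display) (Omega : measurableType disp)
      (P : probability Omega R) (X : R -> {RV P >-> 'rV[R]_d})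
      (psi : 'rV[R]_d -> R[i]) (p : R -> 'rV[R]_d -> R),
    is_levy X -> is_char_exponent X psi -> hartman_wintner psi ->
    is_transition_density X p -> gradient_bound p M T alpha ->
    domain_generator X `<=` Cinfty_gamma alpha).
Proof.
have main := schauder d_gt0 M_gt0 T_gt0 alpha_gt0 alpha_le2.
split=> [rho delta d0|disp Omega P X psi p levyX _ _ densX gradp f [Af genf]].
  have [L _ H] := main rho delta d0.
  exists L => disp Omega P X psi p levyX _ _ densX gradp f Af g.
  exact: (H _ _ _ X p).
have [Cf CAf _] := genf.
(* With [rho = 0] and [delta = 0] the right-hand side is [A f] itself, and membership in the space
   of order 0 is mere boundedness and continuity. *)
have [L _ H] := main 0 0 (lexx 0).
have gE x : Af x + 0 * f x = Af x by rewrite mul0r addr0.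
have [Hf _] := H _ _ _ X p levyX densX gradp f Af Af genf gE
  (C_b_Cb_gamma0 (C_infty_C_b CAf)).
rewrite addr0 in Hf.
by split=> //; exact: domain_Ck_infty.
Qed.
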